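(* Let $A\in\mathbb{R}^{n_x\times n_x}$, $B\in\mathbb{R}^{n_x\times n_u}$ (with $A$ possibly unstable), and let $Q,R,S$ be the LQR weight matrices, with $\begin{bmatrix} Q & S^\top\\ S& R\end{bmatrix}\succ 0$. Let $K_0\in\mathbb{R}^{n_u\times n_x}$ be a fixed pre-stabilizing gain, let $K_\star=-(R+B^\top PB)^{-1}(B^\top PA+S)$ be the optimal state feedback gain, and let $\bar K_\star:=K_\star-K_0$. Suppose $\tau\ge1$, $\rho>0$ are such that both $A+BK_0$ and $A+BK_\star$ are $(\tau,e^{-\rho})$-stable. Let $H\ge1$ be an integer and let $L^{(H)}_\star=\{L^{(H)}_{\star;1},\dots,L^{(H)}_{\star;H}\}$ be the optimal solution (minimizer) of $\min_{L^{(H)}}C(L^{(H)})$, where $C(L^{(H)})$ is the LQR cost of the controller $u_t=K_0x_t+L^{(H)}_1w_{t-1}+\cdots+L^{(H)}_Hw_{t-H}$ with $K_0$ held fixed. Then $$\|\bar K_\star-L^{(H)}_{\star;1}\|\le\frac{2\tau^3\left(\|B\|^2\|\bar K_\star\|\|\bar Q\|+\|B\|\|\bar K_\star\|\|\bar S\|\right)}{\lambda_{\min}(R-\bar S\bar Q^{-1}\bar S^\top)\,(1-e^{-2\rho})^{5/2}}\,e^{-H\rho},$$ where $\bar S:=RK_0+S$ and $\bar Q:=Q+K_0^\top S+S^\top K_0+K_0^\top RK_0$.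
   Context: Notation: $\|\cdot\|$ is the matrix $\ell_2$ (spectral) norm; $\lambda_{\min}(X)$ is the smallest eigenvalue of a symmetric matrix $X$. For $\tau\ge1,\rho>0$, a square matrix $M$ is called $(\tau,e^{-\rho})$-stable if $\|M^k\|\le\tau e^{-\rho k}$ for all integers $k\ge0$. System: $x_{t+1}=Ax_t+Bu_t+w_t$, $t\ge 0$, with $x_t\in\mathbb{R}^{n_x}$, $u_t\in\mathbb{R}^{n_u}$, and $w_t\sim\mathcal{N}(0,I)$ independent over $t\ge 0$; $w_s=0$ for $s<0$; $x_0$ is an arbitrary fixed vector. The weights are $Q\in\mathbb{R}^{n_x\times n_x}$, $Q\succ0$, $R\in\mathbb{R}^{n_u\times n_u}$, $R\succ 0$ (both symmetric), $S\in\mathbb{R}^{n_u\times n_x}$, with $\begin{bmatrix} Q & S^\top\\ S& R\end{bmatrix}\succ 0$. LQR cost: $C=\lim_{T\to\infty}\frac1T\,\mathbb{E}\sum_{t=0}^{T-1}\left(x_t^\top Qx_t+u_t^\top Ru_t+2u_t^\top Sx_t\right)$. $P$ is the optimal cost-to-go matrix, i.e. the unique positive semidefinite solution of the algebraic Riccati equation $P=A^\top PA-(A^\top PB+S^\top)(R+B^\top PB)^{-1}(B^\top PA+S)+Q$; the controller $u_t=K_\star x_t$ is optimal for the LQR problem. For $L^{(H)}=\{L^{(H)}_1,\dots,L^{(H)}_H\}$ with $L^{(H)}_k\in\mathbb{R}^{n_u\times n_x}$, $C(L^{(H)})$ is the LQR cost when $u_t=K_0x_t+\bar u_t$ with $\bar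 u_t=L^{(H)}_1w_{t-1}+\cdots+L^{(H)}_Hw_{t-H}$. Equivalently, with $\bar A:=A+BK_0$, it is $C(L^{(H)})=\lim_{T\to\infty}\frac1T\mathbb{E}\sum_{t=0}^{T-1}\left(x_t^\top\bar Qx_t+\bar u_t^\top R\bar u_t+2\bar u_t^\top\bar Sx_t\right)$ subject to $x_{t+1}=\bar Ax_t+B\bar u_t+w_t$. *)

(* Defs.v *)
From HB Require Import structures.
From mathcomp Require Import all_boot all_order all_algebra finmap.
From mathcomp Require Import all_classical all_reals all_analysis.

Set Implicit Arguments.
Unset Strict Implicit.
Unset Printing Implicit Defensive.

Import Order.TTheory GRing.Theory Num.Theory.
Import numFieldNormedType.Exports.

Local Open Scope classical_set_scope.
Local Open Scope ring_scope.

Section Matrices.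
Context {F : realType}.

Definition l2norm n (v : 'cV[F]_n) : F := Num.sqrt (\sum_i v i 0 ^+ 2).

(* The library norm on matrices is the largest absolute value of an entry. *)
Definition spectral_norm m n (M : 'M[F]_(m, n)) : F :=
  sup [set l2norm (M *m v) | v in [set v : 'cV[F]_n | l2norm v <= 1]].

(* Intended for symmetric X, whose set of real eigenvalues is finite, and
   nonempty when n > 0. *)
Definition lambda_min n (X : 'M[F]_n) : F := inf [set a | eigenvalue X a].

Definition bilin m n (u : 'cV[F]_m) (M : 'M[F]_(m, n)) (v : 'cV[F]_n) : F :=
  (u^T *m M *m v) 0 0.

Definition posdefmx n (X : 'M[F]_n) : Prop :=
  X^T = X /\ forall v : 'cV[F]_n, v != 0 -> 0 < bilin v X v.

Definition possemidefmx n (X : 'M[F]_n) : Prop :=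
  X^T = X /\ forall v : 'cV[F]_n, 0 <= bilin v X v.

Definition exp_stable (tau rho : F) n (M : 'M[F]_n) : Prop :=
  forall k : nat, spectral_norm (M ^+ k) <= tau * expR (- (rho * k%:R)).

End Matrices.

Section Noise.
Context {d : measure_display} {T : measurableType d} {F : realType}.
Variable Pr : probability T F.

Definition mutually_independent (I : choiceType) (G : I -> set (set T)) : Prop :=
  forall (J : {fset I}) (E : I -> set T),
    (forall i, i \in J -> G i (E i)) ->
    Pr (\bigcap_(i in [set` J]) E i) = (\prod_(i <- J) Pr (E i))%E.

Definition generated_by (f : T -> F) : set (set T) :=
  preimage_set_system [set: T] f measurable.

Definition generated_by_family n (X : 'I_n -> T -> F) : set (set T) :=
  <<s \bigcup_(i in [set: 'I_n]) generated_by (X i) >>.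

Definition standard_gaussian n (X : 'I_n -> {RV Pr >-> F}) : Prop :=
  (forall i (V : set F), measurable V ->
     distribution Pr (X i) V = normal_prob 0 1 V) /\
  mutually_independent (fun i => generated_by (X i)).

(* w t i is the i-th coordinate of the noise vector w_t. *)
Definition gaussian_white_noise n (w : nat -> 'I_n -> {RV Pr >-> F}) : Prop :=
  (forall t, standard_gaussian (w t)) /\
  mutually_independent (fun t => generated_by_family (fun i => w t i : T -> F)).

Definition noise_path n (w : nat -> 'I_n -> {RV Pr >-> F}) (om : T)
  : nat -> 'cV[F]_n := fun t => \col_i w t i om.

End Noise.

Section LQR.
Context {F : realType} {nx nu : nat}.
Variables (A : 'M[F]_nx) (B : 'M[F]_(nx, nu)).
Variables (Q : 'M[F]_nx) (R : 'M[F]_nu) (S : 'M[F]_(nu, nx)).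

Definition riccati_solution (P : 'M[F]_nx) : Prop :=
  P = A^T *m P *m A
      - (A^T *m P *m B + S^T) *m invmx (R + B^T *m P *m B)
          *m (B^T *m P *m A + S)
      + Q.

Definition lqr_gain (P : 'M[F]_nx) : 'M[F]_(nu, nx) :=
  - (invmx (R + B^T *m P *m B) *m (B^T *m P *m A + S)).

(* Coefficient L k of a disturbance filter stands for L_(k+1): it multiplies
   the disturbance of k+1 steps ago.  Disturbances at negative times vanish. *)
Definition disturbance_input H (L : 'I_H -> 'M[F]_(nu, nx))
    (w : nat -> 'cV[F]_nx) (t : nat) : 'cV[F]_nu :=
  \sum_(k < H | (k < t)%N) L k *m w (t - k.+1)%N.

Fixpoint state (K0 : 'M[F]_(nu, nx)) H (L : 'I_H -> 'M[F]_(nu, nx))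
    (x0 : 'cV[F]_nx) (w : nat -> 'cV[F]_nx) (t : nat) : 'cV[F]_nx :=
  if t is s.+1 then
    let x := state K0 L x0 w s in
    A *m x + B *m (K0 *m x + disturbance_input L w s) + w s
  else x0.

Definition control (K0 : 'M[F]_(nu, nx)) H (L : 'I_H -> 'M[F]_(nu, nx))
    (x0 : 'cV[F]_nx) (w : nat -> 'cV[F]_nx) (t : nat) : 'cV[F]_nu :=
  K0 *m state K0 L x0 w t + disturbance_input L w t.

Definition stage_cost (x : 'cV[F]_nx) (u : 'cV[F]_nu) : F :=
  bilin x Q x + bilin u R u + 2 * bilin u S x.

Definition lqr_cost {d : measure_display} {T : measurableType d}
    (Pr : probability T F) (w : nat -> 'I_nx -> {RV Pr >-> F})
    (x0 : 'cV[F]_nx) (K0 : 'M[F]_(nu, nx))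
    H (L : 'I_H -> 'M[F]_(nu, nx)) : \bar F :=
  limn (fun N : nat =>
    ((N%:R^-1)%:E *
     'E_Pr[fun om => (\sum_(t < N)
        stage_cost (state K0 L x0 (noise_path w om) t)
                   (control K0 L x0 (noise_path w om) t))%R])%E).

End LQR.

(* Main.v *)
(* The noise being white, the cost of a disturbance filter L is, up to the noise
   variance, the sum over an orthonormal basis of initial states v of the cost of
   the deterministic trajectory started at v with residual input L_k v.  This is
   a quadratic function of L, minimized without the constraint on the length by
   the filter k |-> Kbar (A + B Kstar)^k of the optimal feedback.  Subtracting the
   stationarity conditions of the two minimizers shows that the error D on the
   first H coefficients satisfies <D, D> = <D, E>, where E is the tail of the
   optimal filter and <.,.> is the Hessian.  Minimizing over the state bounds
   <D, D> from below by lambda_min of the Schur complement times the squared norm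
   of D, while <D, E> only involves times after H, where the response to D, the
   response to E and E itself all decay geometrically. *)
Require Import Defs.
From HB Require Import structures.
From mathcomp Require Import all_boot all_order all_algebra finmap ring lra.
From mathcomp Require Import all_classical all_reals all_analysis.
From mathcomp Require Import measurable_realfun.
Import Order.TTheory GRing.Theory Num.Theory.
Import numFieldNormedType.Exports.
Local Open Scope classical_set_scope.
Local Open Scope ring_scope.

Set Implicit Arguments.
Unset Strict Implicit.
Unset Printing Implicit Defensive.

(** The Hessian controls only [d], the l2 norm over the first H times of the error D at a fixed
    vector v, so the cross term has to be bounded linearly in [d]: from lambda d^2 <= C d follows d
    <= C / lambda, and the error on the first coefficient, applied to v, is at most [d]. This fixes
    the constants. Put q = e^(-rho). Cauchy-Schwarz on the convolution giving the response to D
    costs the root of the sum of q^(2k), at most (1 - q^2)^(-1/2), and no factor H. The response to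
    E at time H + m is a sum of m terms of size q^(H+m-1), so the times after H contribute sums of m
    q^(2(m-1)) and of q^(2m); each is at most (1 - q^2)^(-2), whence the factor 2 and the exponent
    5/2. In tau^3, one factor comes from the response to D and two from the response to E, where the
    loop closed by K0 is driven by the loop closed by Kstar. The optimal filter has infinitely many
    coefficients and so lies outside the class over which the cost is minimized; its stationarity is
    needed only along D, which vanishes from time H on, and this finite support also makes the
    series converge. *)

Lemma quadratic_ge0_discr (F : realFieldType) (a b c : F) :
  (forall t, 0 <= a + 2 * b * t + c * t ^+ 2) -> b ^+ 2 <= a * c.
Proof.
move=> h; have [c0|c0] := eqVneq c 0.
  have [-> |b0] := eqVneq b 0; first by rewrite c0 mulr0 expr0n.
  (* An affine function of slope [2 * b] takes the value -1 here. *)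
  have := h (- (a + 1) / (2 * b)); rewrite c0 mul0r addr0.
  by rewrite [2 * b * _]mulrC divfK ?mulf_neq0 ?pnatr_eq0//; lra.
have c_gt0 : 0 < c.
  rewrite lt_def c0 /= leNgt; apply/negP => cn.
  have a0 : 0 <= a by have := h 0; rewrite !expr2; lra.
  (* Averaging the points [s + 1] and [- (s + 1)] removes the linear term; [s] is chosen so that a +
     c (s + 1)^2 <= a + c (s + 1) = c - 1 < 0. *)
  pose s := (a + 1) / - c.
  have cs : c * s = - (a + 1) by rewrite /s invrN mulrN mulrN mulrC divfK.
  have s0 : 0 <= s by apply: divr_ge0; lra.
  have h1 := h (s + 1); have h2 := h (- (s + 1)).
  have : c * (s + 1) ^+ 2 <= c * (s + 1).
    by rewrite ler_nM2l// expr2; nra.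
  have := cs; rewrite !expr2 in h1 h2 *; lra.
have := h (- b / c).
have -> : a + 2 * b * (- b / c) + c * (- b / c) ^+ 2 = (a * c - b ^+ 2) / c.
  by field.
by rewrite pmulr_lge0 ?invr_gt0// subr_ge0.
Qed.

(** * Euclidean and spectral norms *)
Section EuclideanNorm.
Context {F : realType}.
Implicit Types (m n p : nat).

Lemma bilinDl m n (u u' : 'cV[F]_m) (M : 'M[F]_(m, n)) v :
  bilin (u + u') M v = bilin u M v + bilin u' M v.
Proof. by rewrite /bilin linearD /= !mulmxDl mxE. Qed.

Lemma bilinDr m n (u : 'cV[F]_m) (M : 'M[F]_(m, n)) v v' :
  bilin u M (v + v') = bilin u M v + bilin u M v'.
Proof. by rewrite /bilin mulmxDr mxE. Qed.

Lemma bilinZl m n a (u : 'cV[F]_m) (M : 'M[F]_(m, n)) v :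
  bilin (a *: u) M v = a * bilin u M v.
Proof. by rewrite /bilin linearZ /= -!scalemxAl mxE. Qed.

Lemma bilinZr m n a (u : 'cV[F]_m) (M : 'M[F]_(m, n)) v :
  bilin u M (a *: v) = a * bilin u M v.
Proof. by rewrite /bilin -!scalemxAr mxE. Qed.

Lemma bilin0l m n (M : 'M[F]_(m, n)) v : bilin 0 M v = 0.
Proof. by rewrite /bilin trmx0 !mul0mx mxE. Qed.

Lemma bilin0r m n (u : 'cV[F]_m) (M : 'M[F]_(m, n)) : bilin u M 0 = 0.
Proof. by rewrite /bilin mulmx0 mxE. Qed.

Lemma bilinMl m n p (u : 'cV[F]_p) (M : 'M[F]_(m, n)) (N : 'M[F]_(m, p)) v :
  bilin (N *m u) M v = bilin u (N^T *m M) v.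
Proof. by rewrite /bilin trmx_mul !mulmxA. Qed.

Lemma bilinMr m n p (u : 'cV[F]_m) (M : 'M[F]_(m, n)) (N : 'M[F]_(n, p)) v :
  bilin u M (N *m v) = bilin u (M *m N) v.
Proof. by rewrite /bilin !mulmxA. Qed.

Lemma bilin_tr m n (u : 'cV[F]_m) (M : 'M[F]_(m, n)) v :
  bilin v M^T u = bilin u M v.
Proof. by rewrite /bilin -[in LHS]trace_mx11 -mxtrace_tr !trmx_mul !trmxK mulmxA trace_mx11. Qed.

Lemma bilinE m n (u : 'cV[F]_m) (M : 'M[F]_(m, n)) v :
  bilin u M v = \sum_i \sum_j u i 0 * M i j * v j 0.
Proof.
rewrite /bilin mxE exchange_big /=; apply: eq_bigr => j _.
by rewrite mxE big_distrl; apply: eq_bigr => i _; rewrite mxE.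
Qed.

(** Semidefinite forms are allowed because the form is later shifted by its least Rayleigh quotient,
    down to the edge of positivity. *)
Lemma psd_cauchy_schwarz n (Y : 'M[F]_n) (u v : 'cV[F]_n) :
  Y^T = Y -> (forall x, 0 <= bilin x Y x) ->
  bilin u Y v ^+ 2 <= bilin u Y u * bilin v Y v.
Proof.
move=> symY Y0; apply: quadratic_ge0_discr => t.
have := Y0 (u + t *: v).
rewrite !bilinDl !bilinDr !bilinZl !bilinZr -[bilin v Y u]bilin_tr symY.
by rewrite expr2; congr (0 <= _); ring.
Qed.

Lemma l2norm_sqr n (v : 'cV[F]_n) : l2norm v ^+ 2 = bilin v 1%:M v.
Proof.
rewrite sqr_sqrtr ?sumr_ge0// => [|i _]; last exact: sqr_ge0.
by rewrite /bilin mulmx1 mxE; apply: eq_bigr => i _; rewrite mxE expr2.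
Qed.

Lemma l2norm_ge0 n (v : 'cV[F]_n) : 0 <= l2norm v.
Proof. exact: sqrtr_ge0. Qed.

Lemma l2norm_eq0 n (v : 'cV[F]_n) : (l2norm v == 0) = (v == 0).
Proof.
apply/eqP/eqP => [h|->].
  have : \sum_i v i 0 ^+ 2 = 0.
    by rewrite -[LHS]sqr_sqrtr ?[Num.sqrt _]h ?expr0n// sumr_ge0// => i _; exact: sqr_ge0.
  move=> /psumr_eq0P h0; apply/colP => i; rewrite mxE; apply/eqP.
  by rewrite -sqrf_eq0 h0// => j _; exact: sqr_ge0.
by rewrite /l2norm big1 ?sqrtr0// => i _; rewrite mxE expr0n.
Qed.

Lemma l2norm0 n : l2norm (0 : 'cV[F]_n) = 0.
Proof. by apply/eqP; rewrite l2norm_eq0. Qed.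

Lemma l2normZ n a (v : 'cV[F]_n) : l2norm (a *: v) = `|a| * l2norm v.
Proof.
rewrite /l2norm -sqrtr_sqr -sqrtrM ?sqr_ge0// mulr_sumr; congr Num.sqrt.
by apply: eq_bigr => i _; rewrite mxE exprMn.
Qed.

Lemma l2normN n (v : 'cV[F]_n) : l2norm (- v) = l2norm v.
Proof. by rewrite -scaleN1r l2normZ normrN1 mul1r. Qed.

Lemma cauchy_schwarz n (u v : 'cV[F]_n) :
  `|bilin u 1%:M v| <= l2norm u * l2norm v.
Proof.
rewrite -ler_sqr ?nnegrE ?mulr_ge0 ?l2norm_ge0 ?normr_ge0// real_normK ?num_real//.
rewrite exprMn !l2norm_sqr; apply: psd_cauchy_schwarz; first exact: trmx1.
by move=> x; rewrite -l2norm_sqr sqr_ge0.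
Qed.

Lemma l2normD n (u v : 'cV[F]_n) : l2norm (u + v) <= l2norm u + l2norm v.
Proof.
rewrite -ler_sqr ?nnegrE ?addr_ge0 ?l2norm_ge0//.
rewrite l2norm_sqr bilinDl !bilinDr -!l2norm_sqr sqrrD.
rewrite -[bilin v _ u]bilin_tr trmx1.
have := cauchy_schwarz u v; have := ler_norm (bilin u 1%:M v).
by rewrite -mulr_natr; lra.
Qed.

Lemma l2norm_sum n (I : Type) (r : seq I) (P : pred I) (f : I -> 'cV[F]_n) :
  l2norm (\sum_(i <- r | P i) f i) <= \sum_(i <- r | P i) l2norm (f i).
Proof.
elim/big_rec2: _ => [|i y x _ h]; first by rewrite l2norm0.
by apply: le_trans (l2normD _ _) _; rewrite lerD2l.
Qed.

Lemma sum_cauchy_schwarz n (f g : 'I_n -> F) :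
  \sum_i f i * g i <= Num.sqrt (\sum_i f i ^+ 2) * Num.sqrt (\sum_i g i ^+ 2).
Proof.
have := cauchy_schwarz (\col_i f i) (\col_i g i).
rewrite /l2norm => h; apply: le_trans (ler_norm _) _.
rewrite [X in `|X|](_ : _ = bilin (\col_i f i) 1%:M (\col_i g i)).
  apply: le_trans h _; rewrite le_eqVlt; apply/orP; left; apply/eqP.
  by congr (Num.sqrt _ * Num.sqrt _); apply: eq_bigr => i _; rewrite mxE.
by rewrite /bilin mulmx1 mxE; apply: eq_bigr => i _; rewrite !mxE.
Qed.

Lemma l2norm_entry n (v : 'cV[F]_n) i : `|v i 0| <= l2norm v.
Proof.
rewrite -ler_sqr ?nnegrE ?l2norm_ge0// real_normK ?num_real//.
rewrite sqr_sqrtr ?sumr_ge0// => [|j _]; last exact: sqr_ge0.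
by rewrite (bigD1 i)//= lerDl sumr_ge0// => j _; exact: sqr_ge0.
Qed.

(** A crude constant is enough: its purpose is to make the set in [spectral_norm] bounded, so that
    [sup] is a genuine supremum and not a default value. *)
Lemma l2norm_mulmx_bounded m n (M : 'M[F]_(m, n)) :
  exists2 C, 0 <= C & forall v, l2norm (M *m v) <= C * l2norm v.
Proof.
exists (\sum_j l2norm (col j M)).
  by apply: sumr_ge0 => j _; exact: l2norm_ge0.
move=> v; have -> : M *m v = \sum_j v j 0 *: col j M.
  apply/colP => i; rewrite mxE summxE; apply: eq_bigr => j _.
  by rewrite !mxE mulrC.
apply: le_trans (l2norm_sum _ _ _) _; rewrite mulr_suml; apply: ler_sum => j _.
by rewrite l2normZ mulrC ler_wpM2l ?l2norm_ge0// l2norm_entry.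
Qed.

Lemma spectral_norm_has_sup m n (M : 'M[F]_(m, n)) :
  has_sup [set l2norm (M *m v) | v in [set v : 'cV[F]_n | l2norm v <= 1]].
Proof.
have [C C0 hC] := l2norm_mulmx_bounded M; split.
  by exists (l2norm (M *m 0)); exists 0 => //=; rewrite l2norm0.
exists C => _ [v /= v1 <-]; apply: le_trans (hC v) _.
by rewrite -[leRHS]mulr1 ler_wpM2l.
Qed.

Lemma spectral_norm_le m n (M : 'M[F]_(m, n)) c :
  (forall v, l2norm v <= 1 -> l2norm (M *m v) <= c) -> spectral_norm M <= c.
Proof.
move=> h; apply: ge_sup; first by have [] := spectral_norm_has_sup M.
by move=> _ [v v1 <-]; exact: h.
Qed.

Lemma spectral_norm_ge0 m n (M : 'M[F]_(m, n)) : 0 <= spectral_norm M.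
Proof.
apply: ub_le_sup; first by have [] := spectral_norm_has_sup M.
by exists 0 => /=; rewrite ?mulmx0 l2norm0.
Qed.

Lemma l2norm_mulmx m n (M : 'M[F]_(m, n)) v :
  l2norm (M *m v) <= spectral_norm M * l2norm v.
Proof.
have [->|v0] := eqVneq v 0; first by rewrite mulmx0 !l2norm0 mulr0.
have nv : 0 < l2norm v by rewrite lt_def l2norm_eq0 v0 l2norm_ge0.
rewrite -ler_pdivrMr//; apply: ub_le_sup.
  by have [] := spectral_norm_has_sup M.
exists ((l2norm v)^-1 *: v) => /=.
  by rewrite l2normZ ger0_norm ?invr_ge0 ?l2norm_ge0// mulVf ?gt_eqF.
by rewrite -scalemxAr l2normZ ger0_norm ?invr_ge0 ?l2norm_ge0// mulrC.
Qed.

Lemma bilin_le m n (u : 'cV[F]_m) (M : 'M[F]_(m, n)) v :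
  `|bilin u M v| <= l2norm u * (spectral_norm M * l2norm v).
Proof.
rewrite -[M]mul1mx -bilinMr mul1mx; apply: le_trans (cauchy_schwarz _ _) _.
by rewrite ler_wpM2l ?l2norm_ge0// l2norm_mulmx.
Qed.

(* If the infimum a of the Rayleigh quotient were no eigenvalue, X - a would be
   positive semidefinite and invertible, and Cauchy-Schwarz for the form X - a
   would bound it below by a positive multiple of the identity. *)
Lemma exists_least_rayleigh_eigenvalue n (X : 'M[F]_n) : (0 < n)%N -> X^T = X ->
  exists2 a, eigenvalue X a & forall v, a * l2norm v ^+ 2 <= bilin v X v.
Proof.
move=> n0 symX.
pose E := [set bilin v X v | v in [set v : 'cV[F]_n | l2norm v = 1]].
have E0 : E !=set0.
  pose e : 'cV[F]_n := const_mx 1.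
  have e0 : l2norm e != 0.
    rewrite l2norm_eq0; apply/eqP => /colP /(_ (Ordinal n0)); rewrite !mxE.
    by move/eqP; rewrite oner_eq0.
  exists (bilin ((l2norm e)^-1 *: e) X ((l2norm e)^-1 *: e)).
  exists ((l2norm e)^-1 *: e) => //=.
  by rewrite l2normZ ger0_norm ?invr_ge0 ?l2norm_ge0// mulVf.
have lbE : has_inf E.
  split => //; exists (- spectral_norm X) => _ [v /= v1 <-].
  have := bilin_le v X v; rewrite v1 mul1r mulr1 ler_norml.
  by case/andP.
have ray v : inf E * l2norm v ^+ 2 <= bilin v X v.
  have [->|v0] := eqVneq v 0; first by rewrite l2norm0 expr0n mulr0 bilin0l.
  have nv : 0 < l2norm v by rewrite lt_def l2norm_eq0 v0 l2norm_ge0.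
  have : inf E <= bilin ((l2norm v)^-1 *: v) X ((l2norm v)^-1 *: v).
    apply: ge_inf; first by case: lbE.
    exists ((l2norm v)^-1 *: v) => //=.
    by rewrite l2normZ ger0_norm ?invr_ge0 ?l2norm_ge0// mulVf ?gt_eqF.
  rewrite bilinZl bilinZr mulrA -invfM -expr2 mulrC.
  by rewrite ler_pdivlMr ?exprn_gt0.
exists (inf E) => //.
pose Y := X - (inf E)%:M.
have bY v : bilin v Y v = bilin v X v - inf E * l2norm v ^+ 2.
  by rewrite l2norm_sqr /bilin mulmxBr mulmxBl mulmx1 mul_mx_scalar -scalemxAl !mxE.
have symY : Y^T = Y by rewrite /Y linearB /= symX tr_scalar_mx.
have Y0 v : 0 <= bilin v Y v by rewrite bY subr_ge0.
rewrite /eigenvalue /eigenspace -/Y kermx_eq0 row_free_unit.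
apply/negP => uY.
(* Cauchy-Schwarz is tested against [invmx Y *m v]: the left side becomes l2norm v ^ 4 = 1, and the
   second factor on the right is the form of [invmx Y] at v, at most its spectral norm. *)
have key v : l2norm v = 1 -> 1 <= bilin v Y v * spectral_norm (invmx Y).
  move=> v1; have := psd_cauchy_schwarz v (invmx Y *m v) symY Y0.
  rewrite [bilin v Y _]bilinMr mulmxV// -l2norm_sqr v1 !expr1n.
  move=> /le_trans; apply; rewrite ler_wpM2l//.
  rewrite bilinMl bilinMr -mulmxA mulmxV// mulmx1 -bilin_tr trmxK.
  apply: le_trans (ler_norm _) _; apply: le_trans (bilin_le _ _ _) _.
  by rewrite v1 mul1r mulr1.
have C0 : 0 < spectral_norm (invmx Y).
  have [_ [v /= v1 _]] := E0.
  rewrite lt_def spectral_norm_ge0 andbT; apply/eqP => C0.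
  by have := key _ v1; rewrite C0 mulr0 ler10.
have : inf E + (spectral_norm (invmx Y))^-1 <= inf E.
  apply: lb_le_inf => // _ [v /= v1 <-].
  have := key _ v1; rewrite -ler_pdivrMr// div1r bY v1 expr1n mulr1.
  by lra.
by rewrite gerDl leNgt invr_gt0 C0.
Qed.

(** Eigenvectors of the library are rows multiplied from the left, hence the transposition. *)
Lemma eigenvalue_col n (X : 'M[F]_n) a : X^T = X -> eigenvalue X a ->
  exists2 v : 'cV[F]_n, v != 0 & bilin v X v = a * l2norm v ^+ 2.
Proof.
move=> symX /eigenvalueP [v hv v0]; exists v^T.
  by rewrite -trmx_eq0 trmxK.
by rewrite l2norm_sqr /bilin trmxK hv -scalemxAl mulmx1 mxE.
Qed.

(** The least Rayleigh quotient is an eigenvalue and, evaluated at eigenvectors, a lower bound of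
    all the others. In dimension 0 the set of eigenvalues is empty and [inf] carries no
    information. *)
Lemma lambda_min_spec n (X : 'M[F]_n) : (0 < n)%N -> X^T = X ->
  eigenvalue X (lambda_min X) /\
  forall v, lambda_min X * l2norm v ^+ 2 <= bilin v X v.
Proof.
move=> n0 symX; have [a Xa ha] := exists_least_rayleigh_eigenvalue n0 symX.
suff -> : lambda_min X = a by [].
have lba : lbound [set b | eigenvalue X b] a.
  move=> b /= /(eigenvalue_col symX) [v v0 hv].
  have := ha v; rewrite hv ler_pM2r// exprn_gt0//.
  by rewrite lt_def l2norm_eq0 v0 l2norm_ge0.
apply/eqP; rewrite eq_le; apply/andP; split; first by apply: ge_inf => //; exists a.
by apply: lb_le_inf => //; exists a.
Qed.

Lemma lambda_min_gt0 n (X : 'M[F]_n) : (0 < n)%N -> posdefmx X ->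
  0 < lambda_min X.
Proof.
move=> n0 [symX X0]; have [/(eigenvalue_col symX) [v v0 hv] _] := lambda_min_spec n0 symX.
have := X0 _ v0; rewrite hv pmulr_lgt0// exprn_gt0//.
by rewrite lt_def l2norm_eq0 v0 l2norm_ge0.
Qed.

(** A nonzero row of the kernel would be a nonzero vector at which the form vanishes. *)
Lemma posdefmx_unit n (X : 'M[F]_n) : posdefmx X -> X \in unitmx.
Proof.
move=> [symX X0]; rewrite -row_free_unit -kermx_eq0; apply/eqP/row_matrixP => i.
rewrite row0; apply/eqP; apply: contraT => ki.
have := X0 (row i (kermx X))^T; rewrite -trmx_eq0 trmxK ki => /(_ isT).
by rewrite /bilin trmxK -row_mul mulmx_ker row0 mul0mx mxE ltxx.
Qed.

End EuclideanNorm.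

(** * Moments and independence of normal variables *)
Section NormalMoments.
Context {F : realType}.
Local Open Scope ereal_scope.
Local Notation mu := (@lebesgue_measure F).
Local Notation N01 := (@normal_prob F 0%R 1%R).

Lemma normal_pdf_centered (s x : F) : s != 0%R ->
  normal_pdf 0 s x = (normal_peak s * expR (- x ^+ 2 / (s ^+ 2 *+ 2)))%R.
Proof. by move=> s0; rewrite normal_pdfE// /normal_fun subr0. Qed.

(** Change of measure produces a Radon-Nikodym derivative, which agrees with the density only almost
    everywhere; equal integrals over all measurable sets justify the replacement. *)
Lemma ge0_integral_normal_prob (m s : F) (f : F -> \bar F) :
  measurable_fun [set: F] f -> (forall x, 0 <= f x) ->
  \int[normal_prob m s]_x f x = \int[mu]_x (f x * (normal_pdf m s x)%:E).
Proof.
move=> mf f0; have dom := @normal_prob_dominates F m s.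
rewrite -(Radon_Nikodym_SigmaFinite.change_of_variables dom)//.
have mpdf : measurable_fun [set: F] (fun x => (normal_pdf m s x)%:E).
  by apply/measurable_EFinP; exact: measurable_normal_pdf.
have iRN := Radon_Nikodym_SigmaFinite.f_integrable dom.
apply: ae_eq_integral => //.
- by apply: emeasurable_funM => //; exact: (measurable_int mu).
- exact: emeasurable_funM.
- apply: ae_eqe_mul2l; apply: integral_ae_eq => //= E _ mE.
  by rewrite -Radon_Nikodym_SigmaFinite.f_integral.
Qed.

(** This symmetry yields the zero mean without computing an integral. *)
Lemma normal_probN (A : set F) : measurable A ->
  N01 ((-%R : F -> F) @^-1` A) = N01 A.
Proof.
move=> mA; rewrite /normal_prob.
have mpdf : measurable_fun [set: F] (fun x : F => (normal_pdf 0 1 x)%:E).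
  by apply/measurable_EFinP; exact: measurable_normal_pdf.
have mN : measurable_fun [set: F] (-%R : F -> F) by exact: oppr_measurable.
transitivity (\int[pushforward mu (-%R : _ -> measurableTypeR F)]_(x in A)
   (normal_pdf 0 1 x)%:E); last first.
  by apply: eq_measure_integral => //= B mB _; exact: lebesgue_measureN.
rewrite ge0_integral_pushforward//=; first last.
- by move=> x _; rewrite lee_fin normal_pdf_ge0.
- exact: measurable_funTS.
apply: eq_integral => x _ /=.
by rewrite !normal_pdf_centered ?oner_neq0// sqrrN.
Qed.

Lemma integrable_normal_sqr :
  (N01.-integrable [set: F] (fun x => (x ^+ 2)%:E)).
Proof.
have msqr : measurable_fun [set: F] (fun x : F => (x ^+ 2)%:E).
  by apply/measurable_EFinP; exact: exprn_measurable.
apply/integrableP; split => //.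
under eq_integral do rewrite abse_EFin ger0_norm ?sqr_ge0//.
rewrite ge0_integral_normal_prob//; last by move=> x; rewrite lee_fin sqr_ge0.
(* The integrand is dominated by a multiple of the density of variance 2. With y = x^2 / 4 the claim
   is 4 y e^(-2y) <= 4 e^(-y), that is y <= e^y; [C] corrects for the two peaks. *)
pose s := Num.sqrt (2 : F); have s2 : (s ^+ 2 = 2)%R by rewrite sqr_sqrtr.
have s0 : s != 0%R by rewrite sqrtr_eq0 -ltNge.
pose C := (4 * normal_peak 1 / normal_peak s)%R.
have C0 : (0 <= C)%R.
  by rewrite /C !mulr_ge0 ?normal_peak_ge0// invr_ge0 normal_peak_ge0.
have iC : mu.-integrable [set: F] (fun x => C%:E * (normal_pdf 0 s x)%:E).
  by apply: integrableZl => //; exact: integrable_normal_pdf.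
apply: le_lt_trans (_ : \int[mu]_x (C%:E * (normal_pdf 0 s x)%:E) < +oo).
  apply: ge0_le_integral => //.
  - by move=> x _; rewrite mule_ge0// lee_fin ?sqr_ge0// normal_pdf_ge0.
  - apply: emeasurable_funM => //.
    by apply/measurable_EFinP; exact: measurable_normal_pdf.
  - exact: (measurable_int mu).
  - move=> x _; rewrite -!EFinM lee_fin.
    rewrite !normal_pdf_centered ?oner_neq0// s2 expr1n.
    rewrite /C.
    have -> : (4 * normal_peak 1 / normal_peak s *
        (normal_peak s * expR (- x ^+ 2 / (2 *+ 2))) =
        normal_peak 1 * (4 * expR (- x ^+ 2 / (2 *+ 2))) :> F)%R.
      by field; rewrite gt_eqF// normal_peak_gt0.
    rewrite mulrCA ler_wpM2l ?normal_peak_ge0//.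
    pose y := (x ^+ 2 / 4)%R.
    have -> : (- x ^+ 2 / (1 *+ 2) = - y + - y :> F)%R.
      by rewrite -mulr_natr /y; field.
    have -> : (- x ^+ 2 / (2 *+ 2) = - y :> F)%R.
      by rewrite -mulr_natr /y; field.
    have -> : (x ^+ 2 = 4 * y)%R by rewrite /y; field.
    rewrite expRD -mulrA ler_pM2l// mulrA ler_piMl ?expR_ge0// expRN.
    rewrite ler_pdivrMr ?expR_gt0// mul1r.
    by apply: le_trans (expR_ge1Dx y); rewrite lerDr.
rewrite ge0_integralZl//; last first.
- by move=> x _; rewrite lee_fin normal_pdf_ge0.
- by apply/measurable_EFinP; exact: measurable_normal_pdf.
by rewrite integral_normal_pdf mule1 ltry.
Qed.

Lemma integrable_normal_id : N01.-integrable [set: F] (fun x => x%:E).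
Proof.
have ig : N01.-integrable [set: F] (fun x : F => (x ^+ 2 + 1)%:E).
  have -> : (fun x : F => (x ^+ 2 + 1)%:E) = (fun x => (x ^+ 2)%:E) \+ (EFin \o cst 1%R).
    by apply/funext => x /=; rewrite EFinD.
  apply: integrableD => //; first exact: integrable_normal_sqr.
  exact: finite_measure_integrable_cst.
apply: le_integrable ig => //; first exact/measurable_EFinP.
move=> x _; rewrite !abse_EFin lee_fin [leRHS]ger0_norm ?addr_ge0 ?sqr_ge0//.
rewrite -(real_normK (num_real x)); have := sqr_ge0 (`|x| - 2^-1)%R.
by rewrite !expr2; lra.
Qed.

(** By symmetry the integral equals its own opposite; being finite, it is zero. *)
Lemma integral_normal_id : \int[N01]_x x%:E = 0.
Proof.
have fin := integrable_fin_num measurableT integrable_normal_id.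
have mN : measurable_fun [set: F] (-%R : F -> F) by exact: oppr_measurable.
have iN : N01.-integrable ((-%R : F -> F) @^-1` setT) (EFin \o -%R).
  rewrite preimage_setT (_ : _ \o _ = fun x => - (x%:E)).
    by apply: integrableN; exact: integrable_normal_id.
  by apply/funext => x.
suff : \int[N01]_x x%:E = - \int[N01]_x x%:E.
  move: fin; case: (\int[N01]_x x%:E) => // r _ [] h.
  by congr EFin; lra.
transitivity (\int[pushforward N01 (-%R : _ -> measurableTypeR F)]_x x%:E).
  by apply: eq_measure_integral => //= A mA _; exact/esym/normal_probN.
rewrite integral_pushforward//=.
rewrite preimage_setT -(integralN (integrable_add_def _ integrable_normal_id))//.
Qed.

(** A zero integral would concentrate the law at the origin, a point that is null by absolute
    continuity. *)
Lemma integral_normal_sqr_gt0 : 0 < \int[N01]_x (x ^+ 2)%:E.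
Proof.
rewrite lt_def integral_ge0 ?andbT; last by move=> x _; rewrite lee_fin sqr_ge0.
apply/eqP => int0.
have msqr : measurable_fun [set: F] (fun x : F => (x ^+ 2)%:E).
  by apply/measurable_EFinP; exact: exprn_measurable.
have : ae_eq N01 setT (fun x : F => (x ^+ 2)%:E) (cst 0).
  apply/ae_eq_integral_abs => //.
  by under eq_integral do rewrite abse_EFin ger0_norm ?sqr_ge0//.
move=> [A [mA A0 hA]].
have N0 : N01 [set 0%R] = 0.
  move: (@normal_prob_dominates F 0%R 1%R) => /null_content_dominatesP; apply => //.
  exact: lebesgue_measure_set1.
have : N01 [set: F] <= N01 (A `|` [set 0%R]).
  apply: le_measure; rewrite ?inE//; first exact: measurableU.
  move=> x _; have [->|x0] := eqVneq x 0%R; first by right.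
  left; apply: hA => /= /(_ Logic.I) /eqP.
  by rewrite eqe sqrf_eq0 (negbTE x0).
rewrite measureU0// A0 probability_setT.
by rewrite lee_fin ler10.
Qed.

End NormalMoments.

(** * Means of sums and products of normal variables *)

Section Mean.
Context {d : measure_display} {T : measurableType d} {F : realType}.
Variable Pr : probability T F.

(** Integrability travels with the value, so that the rules for sums and multiples compose without
    side conditions. *)
Definition has_mean (f : T -> F) (a : F) : Prop :=
  Pr.-integrable setT (EFin \o f) /\ (\int[Pr]_x (f x)%:E = a%:E)%E.

Lemma has_meanE f a : has_mean f a -> ('E_Pr[f] = a%:E)%E.
Proof. by case=> _ <-; rewrite unlock. Qed.

Lemma has_mean_cst a : has_mean (fun=> a) a.
Proof.
split; first exact: finite_measure_integrable_cst.
by have := expectation_cst Pr a; rewrite unlock.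
Qed.

Lemma has_meanD f g a b :
  has_mean f a -> has_mean g b -> has_mean (fun x => f x + g x) (a + b).
Proof.
move=> [fi fE] [gi gE]; split.
  have -> : EFin \o (fun x => f x + g x) = ((EFin \o f) \+ (EFin \o g))%E.
    by apply/funext => x.
  exact: integrableD.
by rewrite EFinD -fE -gE -integralD.
Qed.

Lemma has_meanZ c f a : has_mean f a -> has_mean (fun x => c * f x) (c * a).
Proof.
move=> [fi fE]; split.
  have -> : EFin \o (fun x => c * f x) = (fun x => c%:E * (EFin \o f) x)%E.
    by apply/funext => x.
  exact: integrableZl.
by rewrite EFinM -fE -integralZl.
Qed.

Lemma has_mean_sum (I : Type) (r : seq I) (P : pred I) (f : I -> T -> F) a :
  (forall i, P i -> has_mean (f i) (a i)) ->
  has_mean (fun x => \sum_(i <- r | P i) f i x) (\sum_(i <- r | P i) a i).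
Proof.
move=> h; elim: r => [|i r IH].
  by rewrite big_nil; under eq_fun do rewrite big_nil; exact: has_mean_cst.
rewrite big_cons; under eq_fun do rewrite big_cons.
by case: ifP => // Pi; apply: has_meanD => //; exact: h.
Qed.

Lemma mutually_independent2 (I : choiceType) (G : I -> set (set T)) i j A B :
  mutually_independent Pr G -> i != j -> G i A -> G j B ->
  (Pr (A `&` B) = Pr A * Pr B)%E.
Proof.
move=> ind ij GA GB.
have := ind [fset i; j]%fset (fun k => if k == i then A else B).
rewrite big_fsetU1/= ?inE// big_seq_fset1 eqxx [j == i]eq_sym (negbTE ij).
move=> <- => [|k]; last first.
  rewrite !inE => /orP[/eqP ->|/eqP ->]; first by rewrite eqxx.
  by rewrite eq_sym (negbTE ij).
congr (Pr _); apply/seteqP; split => [x [Ax Bx] k /=|x h].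
  by case: eqP.
split; first by have := h i; rewrite eqxx; apply; rewrite /= !inE eqxx.
by have := h j; rewrite eq_sym (negbTE ij); apply; rewrite /= !inE eqxx orbT.
Qed.

Section StandardNormal.
Local Open Scope ereal_scope.

(* F and measurableTypeR F have the same Borel sets but different displays;
   normal_prob is a measure on the latter. *)
Local Notation Rm := (measurableTypeR F).
Local Notation N01 := (@normal_prob F 0%R 1%R).

Lemma measurable_mfunR (X : {mfun T >-> Rm}) : measurable_fun setT (X : T -> F).
Proof. by move=> mD A mA; exact: (@measurable_funPT _ _ _ _ X mD A mA). Qed.

Definition standard_normal (X : {mfun T >-> Rm}) : Prop :=
  forall V : set Rm, measurable V -> Pr (X @^-1` V) = N01 V.

Lemma standard_normal_integrable (X : {mfun T >-> Rm}) (f : Rm -> \bar F) :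
  standard_normal X -> N01.-integrable setT f ->
  Pr.-integrable setT (f \o X).
Proof.
move=> NX /integrableP[mf foo]; apply/integrableP; split.
  exact: measurableT_comp.
have mf' : measurable_fun setT (abse \o f) by exact: measurableT_comp.
have := ge0_integral_pushforward (measurable_funPT X) Pr measurableT (measurable_funTS mf')
  (fun y _ => abse_ge0 (f y)).
rewrite preimage_setT => <-.
rewrite (eq_measure_integral N01) => [//|A mA _].
exact: NX.
Qed.

Lemma standard_normal_mean (X : {mfun T >-> Rm}) (f : Rm -> \bar F) :
  standard_normal X -> N01.-integrable setT f ->
  \int[Pr]_x (f (X x)) = \int[N01]_x f x.
Proof.
move=> NX fi.
have := integral_pushforward (measurable_funPT X) (measurable_int _ fi)
  (standard_normal_integrable NX fi) measurableT.
rewrite preimage_setT => <-.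
by apply: eq_measure_integral => A mA _; exact: NX.
Qed.

(* Its value 1 is irrelevant: a positive finite factor does not affect minimizers. *)
Definition normal_var : F := fine (\int[N01]_x (x ^+ 2)%:E).

Lemma normal_var_gt0 : (0 < normal_var)%R.
Proof.
rewrite fine_gt0// integral_normal_sqr_gt0 /=.
have := integrable_fin_num measurableT (@integrable_normal_sqr F).
by rewrite ge0_fin_numE// integral_ge0// => x _; rewrite lee_fin sqr_ge0.
Qed.

Lemma standard_normal_has_mean0 (X : {mfun T >-> Rm}) :
  standard_normal X -> has_mean X 0%R.
Proof.
move=> NX; split.
  exact: (standard_normal_integrable NX (@integrable_normal_id F)).
rewrite (standard_normal_mean NX (@integrable_normal_id F)).
exact: integral_normal_id.
Qed.

Lemma standard_normal_has_mean_sqr (X : {mfun T >-> Rm}) :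
  standard_normal X -> has_mean (fun x => (X x : F) * X x)%R normal_var.
Proof.
move=> NX; split.
  exact: (standard_normal_integrable NX (@integrable_normal_sqr F)).
rewrite (standard_normal_mean NX (@integrable_normal_sqr F)).
by rewrite fineK//; exact: integrable_fin_num (@integrable_normal_sqr F).
Qed.

(** Independence on rectangles identifies the joint law with the product of the marginals; by Fubini
    the inner integral is a multiple of the mean of Y, which is 0. *)
Lemma independent_standard_normal_has_mean (X Y : {mfun T >-> Rm}) :
  standard_normal X -> standard_normal Y ->
  (forall A B : set Rm, measurable A -> measurable B ->
     Pr (X @^-1` A `&` Y @^-1` B) = Pr (X @^-1` A) * Pr (Y @^-1` B)) ->
  has_mean (fun x => (X x : F) * Y x)%R 0%R.
Proof.
move=> NX NY ind.
have [iX2 _] := standard_normal_has_mean_sqr NX.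
have [iY2 _] := standard_normal_has_mean_sqr NY.
have iXY : Pr.-integrable setT (EFin \o (fun x => (X x : F) * Y x)%R).
  have := integrableD measurableT iX2 iY2.
  apply: le_integrable => //.
    by apply/measurable_EFinP; apply: measurable_funM; exact: measurable_mfunR.
  move=> x _ /=; rewrite lee_fin -!expr2 [leRHS]ger0_norm ?addr_ge0 ?sqr_ge0//.
  rewrite normrM -(real_normK (num_real (X x))) -(real_normK (num_real (Y x))).
  have := sqr_ge0 (`|X x : F| - `|Y x : F|)%R; have := sqr_ge0 (`|X x : F| + `|Y x : F|)%R.
  by rewrite !expr2; nra.
split => //.
pose Z : T -> (Rm * Rm)%type := fun x => (X x, Y x).
have mZ : measurable_fun setT Z by apply: measurable_fun_pair; exact: measurable_funPT.
pose f := fun z : Rm * Rm => ((z.1 : F) * z.2)%:E.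
have mf : measurable_fun setT f.
  by apply/measurable_EFinP; apply: measurable_funM.
pose Zm : {mfun T >-> (Rm * Rm)%type} := HB.pack Z (isMeasurableFun.Build _ _ _ _ _ mZ).
have -> : \int[Pr]_x ((X x : F) * Y x)%:E = \int[pushforward Pr Zm]_z f z.
  have := integral_pushforward mZ mf iXY measurableT.
  by rewrite preimage_setT => ->.
have iZ : (pushforward Pr Zm).-integrable setT f.
  exact: (integrable_pushforward mZ mf iXY measurableT).
pose mX : probability Rm F := distribution Pr X.
pose mY : probability Rm F := distribution Pr Y.
have prodE : forall C, measurable C -> (mX \x mY) C = pushforward Pr Zm C.
  by move=> C mC; exact: product_measure_unique.
have iP : (mX \x mY).-integrable setT f.
  apply/integrableP; split => //.
  by rewrite (eq_measure_integral (pushforward Pr Zm)) => [|A mA _]; [case/integrableP: iZ|exact: prodE].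
transitivity (\int[mX \x mY]_z f z).
  by apply/esym/eq_measure_integral => A mA _; exact: prodE.
rewrite -integral12_prod_meas1// /fubini_F /f /=.
rewrite integral0_eq// => x _.
have mYN A : measurable A -> A `<=` setT -> mY A = N01 A by move=> mA _; exact: NY.
have iY : mY.-integrable setT (fun y : Rm => (y : F)%:E).
  have /integrableP[mid idoo] := @integrable_normal_id F.
  by apply/integrableP; split => //; rewrite (eq_measure_integral N01).
under eq_integral do rewrite EFinM.
rewrite integralZl// (eq_measure_integral N01)//.
by rewrite integral_normal_id mule0.
Qed.

End StandardNormal.
End Mean.

(** * Closed-loop trajectories and their cost *)
Section GeometricSums.
Context {F : realType}.
Implicit Types (r q C : F) (f : nat -> F).

Lemma cvgn_series_geometric_bound f C r : 0 <= r < 1 ->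
  (forall j, `|f j| <= C * r ^+ j) -> cvgn (series f).
Proof.
move=> /andP[r0 r1] fC; apply: normed_cvg.
apply: (series_le_cvg _ _ fC) => [n|n|]; first exact: normr_ge0.
- by apply: le_trans (fC n); exact: normr_ge0.
- by apply: is_cvg_geometric_series; rewrite ger0_norm.
Qed.

Lemma cvgn0_geometric_bound f C r : 0 <= r < 1 ->
  (forall j, `|f j| <= C * r ^+ j) -> f @ \oo --> (0 : F).
Proof.
move=> hr fC; apply: cvg_series_cvg_0.
exact: cvgn_series_geometric_bound hr fC.
Qed.

Lemma sum_expr_le r n : 0 <= r < 1 -> \sum_(m < n) r ^+ m <= (1 - r)^-1.
Proof.
move=> /andP[r0 r1]; rewrite -[leRHS]mul1r ler_pdivlMr ?subr_gt0//.
have := subrX1 r n; have := exprn_ge0 n r0.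
by set S := \sum_(_ < _) _; lra.
Qed.

(** This is the derivative of the geometric sum (1 - r^n) / (1 - r), cleared of its denominator so
    that it holds for every r. *)
Lemma sum_mulrn_expr r n : (\sum_(m < n) m%:R * r ^+ m.-1) * (1 - r) ^+ 2 =
  1 - r ^+ n - n%:R * r ^+ n.-1 * (1 - r).
Proof.
elim: n => [|n IH]; first by rewrite big_ord0 !mul0r expr0 subrr subr0.
rewrite big_ord_recr /= mulrDl IH.
have rn : n%:R * r ^+ n = n%:R * r ^+ n.-1 * r.
  by case: n {IH} => [|n]; rewrite ?mul0r// exprSr mulrA.
rewrite -natr1 [(_ + 1) * _]mulrDl rn [r ^+ n.+1]exprSr; ring.
Qed.

Lemma sum_mulrn_expr_le r n : 0 <= r < 1 ->
  \sum_(m < n) m%:R * r ^+ m.-1 <= (1 - r) ^- 2.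
Proof.
move=> /andP[r0 r1]; rewrite -[leRHS]mul1r ler_pdivlMr ?exprn_gt0 ?subr_gt0//.
rewrite sum_mulrn_expr; have := exprn_ge0 n r0.
have : 0 <= n%:R * r ^+ n.-1 * (1 - r).
  by rewrite !mulr_ge0 ?exprn_ge0 ?subr_ge0// ltW.
by lra.
Qed.

End GeometricSums.

Section Response.
Context {F : realType} {nx nu : nat}.
Variables (Ac : 'M[F]_nx) (B : 'M[F]_(nx, nu)).

(** Allowing [p] columns treats on the same footing a single trajectory and, with [X0 = 1%:M], the
    response to all noise directions at once; [resp_mulmx] passes from one to the other. *)
Fixpoint resp p (X0 : 'M[F]_(nx, p)) (U : nat -> 'M[F]_(nu, p)) (j : nat) :=
  if j is i.+1 then Ac *m resp X0 U i + B *m U i else X0.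

Lemma eq_resp p (X0 : 'M[F]_(nx, p)) U V j : (forall i, (i < j)%N -> U i = V i) ->
  resp X0 U j = resp X0 V j.
Proof.
elim: j => //= j IH h; rewrite IH ?h// => i ij; exact/h/ltnW.
Qed.

Lemma respD p (X0 Y0 : 'M[F]_(nx, p)) U V j :
  resp (X0 + Y0) (fun i => U i + V i) j = resp X0 U j + resp Y0 V j.
Proof. by elim: j => //= j ->; rewrite !mulmxDr addrACA. Qed.

Lemma resp_mulmx p p' (X0 : 'M[F]_(nx, p)) U (M : 'M[F]_(p, p')) j :
  resp (X0 *m M) (fun i => U i *m M) j = resp X0 U j *m M.
Proof. by elim: j => //= j ->; rewrite mulmxDl !mulmxA. Qed.

Lemma respZ p a (X0 : 'M[F]_(nx, p)) U j :
  resp (a *: X0) (fun i => a *: U i) j = a *: resp X0 U j.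
Proof. by elim: j => //= j ->; rewrite scalerDr -!scalemxAr. Qed.

Lemma resp_shift p (X0 : 'M[F]_(nx, p)) U i j :
  resp X0 U (i + j) = resp (resp X0 U i) (fun k => U (i + k)%N) j.
Proof. by elim: j => [|j IH]; rewrite ?addn0// addnS /= IH. Qed.

Lemma resp_sum p (X0 : 'M[F]_(nx, p)) U j :
  resp X0 U j = Ac ^+ j *m X0 + \sum_(k < j) Ac ^+ (j - k.+1) *m (B *m U k).
Proof.
elim: j => [|j IH]; first by rewrite big_ord0 addr0 expr0 mul1mx.
rewrite /= IH mulmxDr big_ord_recr /= subnn expr0 mul1mx addrA; congr (_ + _ + _).
  by rewrite exprS mulmxA.
rewrite mulmx_sumr; apply: eq_bigr => k _.
by rewrite subSn// exprS !mulmxA.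
Qed.

Lemma resp0_eq0 p (U : nat -> 'M[F]_(nu, p)) j : (forall i, (i < j)%N -> U i = 0) ->
  resp 0 U j = 0.
Proof.
by move=> h; rewrite resp_sum mulmx0 add0r big1// => k _; rewrite h// !mulmx0.
Qed.

Lemma resp_free p (X0 : 'M[F]_(nx, p)) U i j :
  (forall k, (i <= k)%N -> U k = 0) -> resp X0 U (i + j) = Ac ^+ j *m resp X0 U i.
Proof.
move=> h; rewrite resp_shift resp_sum big1 ?addr0// => k _.
by rewrite h ?leq_addr// !mulmx0.
Qed.

End Response.

Section ClosedLoopPair.
Context {F : realType} {nx nu : nat}.
Variables (Q : 'M[F]_nx) (R : 'M[F]_nu) (S : 'M[F]_(nu, nx)).
Variable K0 : 'M[F]_(nu, nx).
Local Notation W := (block_mx Q S^T S R).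

(* u is the input on top of the pre-stabilizing feedback K0 x. *)
Definition closed_loop_pair p (x : 'M[F]_(nx, p)) (u : 'M[F]_(nu, p)) : 'M[F]_(nx + nu, p) :=
  col_mx x (K0 *m x + u).

Local Notation pair := closed_loop_pair.
Local Notation Sbar := (R *m K0 + S).
Local Notation Qbar := (Q + K0^T *m S + S^T *m K0 + K0^T *m R *m K0).

Lemma pair0 (p : nat) : pair (0 : 'M[F]_(nx, p)) 0 = 0.
Proof. by rewrite /pair mulmx0 addr0 col_mx0. Qed.

Lemma pairD p (x y : 'M[F]_(nx, p)) u v : pair (x + y) (u + v) = pair x u + pair y v.
Proof. by rewrite /pair add_col_mx mulmxDr addrACA. Qed.

Lemma pair_mulmx p p' (x : 'M[F]_(nx, p)) u (M : 'M[F]_(p, p')) :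
  pair (x *m M) (u *m M) = pair x u *m M.
Proof. by rewrite /pair mul_col_mx mulmxDl mulmxA. Qed.

Lemma pairZ p a (x : 'M[F]_(nx, p)) u : pair (a *: x) (a *: u) = a *: pair x u.
Proof. by rewrite /pair scale_col_mx scalerDr scalemxAr. Qed.

Lemma bilin_col_mx m1 m2 (x : 'cV[F]_m1) (y : 'cV[F]_m2) n1 n2
    (M : 'M[F]_(m1 + m2, n1 + n2)) x' y' :
  bilin (col_mx x y) M (col_mx x' y') =
  bilin x (ulsubmx M) x' + bilin x (ursubmx M) y'
  + bilin y (dlsubmx M) x' + bilin y (drsubmx M) y'.
Proof.
rewrite /bilin -{1}[M]submxK tr_col_mx mul_row_block mul_row_col !mulmxDl.
by rewrite !mxE addrACA !addrA.
Qed.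

Lemma bilinMD m n (u : 'cV[F]_m) (M N : 'M[F]_(m, n)) v :
  bilin u (M + N) v = bilin u M v + bilin u N v.
Proof. by rewrite /bilin mulmxDr mulmxDl mxE. Qed.

Lemma bilinMB m n (u : 'cV[F]_m) (M N : 'M[F]_(m, n)) v :
  bilin u (M - N) v = bilin u M v - bilin u N v.
Proof. by rewrite /bilin mulmxBr mulmxBl !mxE. Qed.

Lemma stage_costE x u : stage_cost Q R S x u = bilin (col_mx x u) W (col_mx x u).
Proof.
rewrite bilin_col_mx block_mxKul block_mxKur block_mxKdl block_mxKdr bilin_tr.
by rewrite /stage_cost; ring.
Qed.

(** [Qbar] and [Sbar] arise here: they are blocks of the weight [W] after the change of input from u
    to K0 x + u. *)
Lemma bilin_pair (x y : 'cV[F]_nx) (u v : 'cV[F]_nu) : R^T = R ->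
  bilin (pair x u) W (pair y v) =
  bilin x Qbar y + bilin u Sbar y + bilin v Sbar x + bilin u R v.
Proof.
move=> symR.
rewrite bilin_col_mx block_mxKul block_mxKur block_mxKdl block_mxKdr.
rewrite !bilinDl !bilinDr !bilinMl !bilinMr !bilinMD.
rewrite -[bilin x S^T v]bilin_tr trmxK -[bilin x (_ *m R) v]bilin_tr trmx_mul trmxK symR.
by rewrite -!bilinMl -!bilinMr; ring.
Qed.

End ClosedLoopPair.

Definition pow_stable {F : realType} (tau q : F) n (M : 'M[F]_n) : Prop :=
  forall k (v : 'cV[F]_n), l2norm (M ^+ k *m v) <= tau * q ^+ k * l2norm v.

Lemma exp_stable_pow {F : realType} (tau rho : F) n (M : 'M[F]_n) :
  exp_stable tau rho M -> pow_stable tau (expR (- rho)) M.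
Proof.
move=> h k v; apply: le_trans (l2norm_mulmx _ _) _.
rewrite ler_wpM2r ?l2norm_ge0//; apply: le_trans (h k) _.
by rewrite -expRM_natl mulrN [k%:R * _]mulrC.
Qed.

Section Trajectories.
Context {F : realType} {nx nu : nat}.
Variables (A : 'M[F]_nx) (B : 'M[F]_(nx, nu)).
Variables (Q : 'M[F]_nx) (R : 'M[F]_nu) (S : 'M[F]_(nu, nx)).
Variables (K0 : 'M[F]_(nu, nx)) (tau q : F).
Hypothesis symQ : Q^T = Q.
Hypothesis symR : R^T = R.
Hypothesis (tau_ge1 : 1 <= tau) (q_gt0 : 0 < q) (q_lt1 : q < 1).
Local Notation Ac := (A + B *m K0).
Local Notation W := (block_mx Q S^T S R).
Hypothesis Ac_stable : pow_stable tau q Ac.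

Let r01 : 0 <= q ^+ 2 < 1. Proof. by rewrite sqr_ge0 expr_lt1// ltW. Qed.

Definition traj p (X0 : 'M[F]_(nx, p)) (U : nat -> 'M[F]_(nu, p)) j :=
  closed_loop_pair K0 (resp Ac B X0 U j) (U j).

Lemma eq_traj p (X0 : 'M[F]_(nx, p)) U V j : (forall i, U i = V i) ->
  traj X0 U j = traj X0 V j.
Proof. by move=> h; rewrite /traj h; congr closed_loop_pair; apply: eq_resp. Qed.

Lemma trajD p (X0 Y0 : 'M[F]_(nx, p)) U V j :
  traj (X0 + Y0) (fun i => U i + V i) j = traj X0 U j + traj Y0 V j.
Proof. by rewrite /traj respD pairD. Qed.

Lemma traj_mulmx p p' (X0 : 'M[F]_(nx, p)) U (M : 'M[F]_(p, p')) j :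
  traj (X0 *m M) (fun i => U i *m M) j = traj X0 U j *m M.
Proof. by rewrite /traj resp_mulmx pair_mulmx. Qed.

Lemma trajZ p a (X0 : 'M[F]_(nx, p)) U j :
  traj (a *: X0) (fun i => a *: U i) j = a *: traj X0 U j.
Proof. by rewrite /traj respZ pairZ. Qed.

Lemma weight_sym : W^T = W.
Proof. by rewrite tr_block_mx symQ symR trmxK. Qed.

(** The factor q^(-N) absorbs the first N terms: for j < N, q^(j-N) is at least 1, so their total
    bounds each of them. *)
Lemma eventually_free_bound (n : nat) (N : nat) (z : nat -> 'cV[F]_n) c : 0 <= c ->
  (forall m, l2norm (z (N + m)%N) <= c * q ^+ m) ->
  exists2 C, 0 <= C & forall j, l2norm (z j) <= C * q ^+ j.
Proof.
move=> c0 hz; exists (q ^- N * (\sum_(j < N) l2norm (z j) + c)).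
  rewrite mulr_ge0 ?invr_ge0 ?exprn_ge0 ?(ltW q_gt0)// addr_ge0// sumr_ge0// => j _.
  exact: l2norm_ge0.
have s0 : 0 <= \sum_(j < N) l2norm (z j) by rewrite sumr_ge0// => j _; exact: l2norm_ge0.
move=> j; have [jN|Nj] := ltnP j N.
  apply: (@le_trans _ _ (\sum_(j < N) l2norm (z j) + c)).
    rewrite (bigD1 (Ordinal jN))//= -addrA lerDl addr_ge0// sumr_ge0// => k _.
    exact: l2norm_ge0.
  rewrite mulrAC ler_peMl ?addr_ge0// mulrC ler_pdivlMr ?exprn_gt0// mul1r.
  by rewrite ler_wiXn2l ?(ltW q_gt0) ?(ltW q_lt1)// ltnW.
rewrite -(subnKC Nj); apply: le_trans (hz _) _.
rewrite exprD mulrACA mulVf ?expf_neq0 ?gt_eqF// mul1r.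
by rewrite ler_wpM2r ?exprn_ge0 ?(ltW q_gt0)// lerDr.
Qed.

Lemma l2norm_col_mx n1 n2 (x : 'cV[F]_n1) (y : 'cV[F]_n2) :
  l2norm (col_mx x y) <= l2norm x + l2norm y.
Proof.
have -> : col_mx x y = col_mx x 0 + col_mx 0 y by rewrite add_col_mx addr0 add0r.
apply: le_trans (l2normD _ _) _; rewrite /l2norm !big_split_ord /=.
rewrite le_eqVlt; apply/orP; left; apply/eqP; congr (_ + _); congr Num.sqrt.
  rewrite [X in _ + X]big1 ?addr0 => [|i _]; last by rewrite col_mxEd mxE expr0n.
  by apply: eq_bigr => i _; rewrite col_mxEu.
rewrite [X in X + _]big1 ?add0r => [|i _]; last by rewrite col_mxEu mxE expr0n.
by apply: eq_bigr => i _; rewrite col_mxEd.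
Qed.

Section FiniteSupport.
Variables (N : nat) (x0 : 'cV[F]_nx) (U : nat -> 'cV[F]_nu).
Hypothesis U0 : forall k, (N <= k)%N -> U k = 0.

Lemma resp_bound : exists2 C, 0 <= C & forall j, l2norm (resp Ac B x0 U j) <= C * q ^+ j.
Proof.
apply: (@eventually_free_bound _ N _ (tau * l2norm (resp Ac B x0 U N))).
  by rewrite mulr_ge0 ?l2norm_ge0// (le_trans ler01).
by move=> m; rewrite resp_free// mulrAC; exact: Ac_stable.
Qed.

Lemma traj_bound : exists2 C, 0 <= C & forall j, l2norm (traj x0 U j) <= C * q ^+ j.
Proof.
have [C C0 hC] := resp_bound.
have K1 := spectral_norm_ge0 K0.
apply: (@eventually_free_bound _ N _ (C * q ^+ N * (1 + spectral_norm K0))).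
  by rewrite !mulr_ge0 ?exprn_ge0 ?(ltW q_gt0)// addr_ge0.
move=> m; rewrite /traj U0 ?leq_addr// /closed_loop_pair addr0.
apply: le_trans (l2norm_col_mx _ _) _.
have := l2norm_mulmx K0 (resp Ac B x0 U (N + m)).
have := hC (N + m)%N; have := l2norm_ge0 (resp Ac B x0 U (N + m)).
rewrite exprD; set l := l2norm _; move=> l0 h1 h2.
have : (1 + spectral_norm K0) * l <= (1 + spectral_norm K0) * (C * (q ^+ N * q ^+ m)).
  by rewrite ler_wpM2l//; lra.
by lra.
Qed.

End FiniteSupport.

Lemma bilin_geometric_bound m n (M : 'M[F]_(m, n)) (y : nat -> 'cV[F]_m) (z : nat -> 'cV[F]_n) C D :
  0 <= C -> (forall j, l2norm (y j) <= C * q ^+ j) -> (forall j, l2norm (z j) <= D * q ^+ j) ->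
  forall j, `|bilin (y j) M (z j)| <= (C * spectral_norm M * D) * (q ^+ 2) ^+ j.
Proof.
move=> C0 hy hz j; apply: le_trans (bilin_le _ _ _) _.
apply: (@le_trans _ _ ((C * q ^+ j) * (spectral_norm M * (D * q ^+ j)))).
  apply: ler_pM; rewrite ?mulr_ge0 ?l2norm_ge0 ?spectral_norm_ge0//.
  by rewrite ler_wpM2l ?spectral_norm_ge0.
by rewrite -exprM mulnC exprM expr2 le_eqVlt; apply/orP; left; apply/eqP; ring.
Qed.

Definition pair_cost p (Z Z' : 'M[F]_(nx + nu, p)) : F := \tr (Z^T *m W *m Z').

Lemma pair_costE p (Z Z' : 'M[F]_(nx + nu, p)) :
  pair_cost Z Z' = \sum_i bilin (col i Z) W (col i Z').
Proof.
rewrite /pair_cost /mxtrace; apply: eq_bigr => i _.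
rewrite /bilin !mxE; apply: eq_bigr => j _; rewrite !mxE; congr (_ * _).
by apply: eq_bigr => k _; rewrite !mxE.
Qed.

Lemma pair_costC p (Z Z' : 'M[F]_(nx + nu, p)) : pair_cost Z Z' = pair_cost Z' Z.
Proof. by rewrite /pair_cost -mxtrace_tr !trmx_mul trmxK weight_sym mulmxA. Qed.

Lemma pair_cost_expand p (Z Z' : 'M[F]_(nx + nu, p)) a :
  pair_cost (Z + a *: Z') (Z + a *: Z') = pair_cost Z Z + 2 * pair_cost Z Z' * a + pair_cost Z' Z' * a ^+ 2.
Proof.
have -> : pair_cost (Z + a *: Z') (Z + a *: Z') =
    pair_cost Z Z + a * pair_cost Z Z' + a * (pair_cost Z' Z + a * pair_cost Z' Z').
  have trZ : (Z + a *: Z')^T = Z^T + a *: Z'^T by rewrite linearD linearZ.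
  rewrite /pair_cost trZ !mulmxDl !mulmxDr.
  by rewrite -!scalemxAl -!scalemxAr !mxtraceD !mxtraceZ; ring.
by rewrite (pair_costC Z' Z); ring.
Qed.

(** Once the inputs stop, stability makes both trajectories decay like q^j, so the products of
    columns are dominated by a geometric series of ratio q^2. *)
Lemma cvgn_pair_cost p (X0 Y0 : 'M[F]_(nx, p)) U V N :
  (forall k, (N <= k)%N -> U k = 0) -> (forall k, (N <= k)%N -> V k = 0) ->
  cvgn (series (fun j => pair_cost (traj X0 U j) (traj Y0 V j))).
Proof.
move=> U0 V0.
have bound X (U' : nat -> 'M[F]_(nu, p)) i : (forall k, (N <= k)%N -> U' k = 0) ->
    exists2 C, 0 <= C & forall j, l2norm (col i (traj X U' j)) <= C * q ^+ j.
  move=> U'0; have [|C C0 hC] := @traj_bound N (col i X) (fun k => col i (U' k)).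
    by move=> k Nk; rewrite U'0// col0.
  exists C => // j; rewrite colE -traj_mulmx -colE.
  by under eq_traj do rewrite -colE.
have -> : (fun j => pair_cost (traj X0 U j) (traj Y0 V j)) =
    \sum_i (fun j => bilin (col i (traj X0 U j)) W (col i (traj Y0 V j))).
  by apply/funext => j; rewrite fct_sumE pair_costE.
rewrite (_ : series _ = \sum_i series (fun j => bilin (col i (traj X0 U j)) W (col i (traj Y0 V j)))).
  elim/big_ind: _ => [|f g cf cg|i _]; [exact: is_cvg_cst|exact: is_cvgD|].
  have [C C0 hC] := bound X0 U i U0; have [D D0 hD] := bound Y0 V i V0.
  exact: cvgn_series_geometric_bound r01 (bilin_geometric_bound _ C0 hC hD).
by apply/funext => n; rewrite !fct_sumE /series /= exchange_big.
Qed.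

End Trajectories.

(** * Stationarity of the optimal filter of length H *)

Section FirstOrder.
Context {F : realType} {nx nu : nat}.
Variables (A : 'M[F]_nx) (B : 'M[F]_(nx, nu)).
Variables (Q : 'M[F]_nx) (R : 'M[F]_nu) (S : 'M[F]_(nu, nx)).
Variables (K0 : 'M[F]_(nu, nx)) (tau q : F).
Hypothesis symQ : Q^T = Q.
Hypothesis symR : R^T = R.
Hypothesis (tau_ge1 : 1 <= tau) (q_gt0 : 0 < q) (q_lt1 : q < 1).
Local Notation Ac := (A + B *m K0).
Local Notation W := (block_mx Q S^T S R).
Hypothesis Ac_stable : pow_stable tau q Ac.


Local Notation traj := (traj A B K0).
Local Notation pair_cost := (pair_cost Q R S).

(** Padding by zero makes a filter of length H an input over all times, comparable with the infinite
    optimal one. *)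
Definition extend H (L : 'I_H -> 'M[F]_(nu, nx)) (j : nat) : 'M[F]_(nu, nx) :=
  if insub j is Some k then L k else 0.

Lemma extend_lt H (L : 'I_H -> 'M[F]_(nu, nx)) (k : 'I_H) : extend L k = L k.
Proof. by rewrite /extend valK. Qed.

Lemma extend_ge H (L : 'I_H -> 'M[F]_(nu, nx)) k : (H <= k)%N -> extend L k = 0.
Proof. by move=> Hk; rewrite /extend insubF// ltnNge Hk. Qed.

Definition filter_cost H (L : 'I_H -> 'M[F]_(nu, nx)) : F :=
  limn (series (fun j => pair_cost (traj 1%:M (extend L) j) (traj 1%:M (extend L) j))).

(* Perturbing L by D v^T reduces the trace form to the bilinear form at the single
   initial state v, so the final bound has no dimension factor. *)
Lemma filter_cost_first_order H (L : 'I_H -> 'M[F]_(nu, nx)) :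
  (forall L' : 'I_H -> 'M[F]_(nu, nx), filter_cost L <= filter_cost L') ->
  forall (v : 'cV[F]_nx) (D : nat -> 'cV[F]_nu), (forall k, (H <= k)%N -> D k = 0) ->
  series (fun j => bilin (traj 0 D j) W (traj v (fun k => extend L k *m v) j))
    @ \oo --> (0 : F).
Proof.
move=> Lmin v D D0; pose V k := D k *m v^T.
have V0 k : (H <= k)%N -> V k = 0 by move=> Hk; rewrite /V D0// mul0mx.
have L0 := @extend_ge H L.
pose Z := traj 1%:M (extend L); pose Z' := traj 0 V.
have cross j : pair_cost (Z j) (Z' j) =
    bilin (traj 0 D j) W (traj v (fun k => extend L k *m v) j).
  have -> : Z' j = traj 0 D j *m v^T by rewrite -traj_mulmx mul0mx.
  have -> : traj v (fun k => extend L k *m v) j = Z j *m v.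
    by rewrite -traj_mulmx mul1mx.
  rewrite pair_costC// /pair_cost trmx_mul trmxK -!mulmxA mxtrace_mulC -!mulmxA.
  by rewrite trace_mx11 /bilin !mulmxA.
pose b := limn (series (fun j => pair_cost (Z j) (Z' j))).
have cb : series (fun j => pair_cost (Z j) (Z' j)) @ \oo --> b.
  exact: (cvgn_pair_cost tau_ge1 q_gt0 q_lt1 Ac_stable L0 V0).
suff b0 : b = 0.
  by move: cb; rewrite b0 (_ : (fun j => _) = fun j =>
    bilin (traj 0 D j) W (traj v (fun k => extend L k *m v) j))//; apply/funext.
pose c := limn (series (fun j => pair_cost (Z' j) (Z' j))).
have cc : series (fun j => pair_cost (Z' j) (Z' j)) @ \oo --> c.
  exact: (cvgn_pair_cost tau_ge1 q_gt0 q_lt1 Ac_stable V0 V0).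
have ca : series (fun j => pair_cost (Z j) (Z j)) @ \oo --> filter_cost L.
  exact: (cvgn_pair_cost tau_ge1 q_gt0 q_lt1 Ac_stable L0 L0).
(* Along L + a V the cost exceeds its minimum by 2 b a + c a^2, a nonnegative polynomial in a
   without constant term, so its discriminant bound forces b = 0. *)
have : b ^+ 2 <= 0 * c.
  apply: quadratic_ge0_discr => a; rewrite add0r.
  have := Lmin (fun k => L k + a *: V k); rewrite -subr_ge0; congr (0 <= _).
  apply/eqP; rewrite subr_eq; apply/eqP; apply/cvg_lim => //.
  have -> : 2 * b * a + c * a ^+ 2 + filter_cost L =
    filter_cost L + (2 * a) * b + a ^+ 2 * c by ring.
  rewrite (_ : series _ = series (fun j => pair_cost (Z j) (Z j)) \+
      (fun n => (2 * a) * series (fun j => pair_cost (Z j) (Z' j)) n) \+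
      (fun n => a ^+ 2 * series (fun j => pair_cost (Z' j) (Z' j)) n)).
    by apply: cvgD; [apply: cvgD => //|]; exact: cvgMl_tmp.
  apply/funext => n /=; rewrite /series /= !mulr_sumr -!big_split /=.
  apply: eq_bigr => j _.
  have -> : traj 1%:M (extend (fun k => L k + a *: V k)) j = Z j + a *: Z' j.
    rewrite -trajZ scaler0 -trajD addr0; apply: eq_traj => i.
    have [iH|Hi] := ltnP i H; last by rewrite !extend_ge// V0// scaler0 addr0.
    by rewrite -[i]/(val (Ordinal iH)) !extend_lt.
  by rewrite pair_cost_expand//; ring.
by rewrite mul0r real_exprn_even_le0 ?num_real//= => /eqP.
Qed.

End FirstOrder.

(** * Stationarity identities from the Riccati equation *)

Section Riccati.
Context {F : realType} {nx nu : nat}.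
Variables (A : 'M[F]_nx) (B : 'M[F]_(nx, nu)).
Variables (Q : 'M[F]_nx) (R : 'M[F]_nu) (S : 'M[F]_(nu, nx)).
Variables (P : 'M[F]_nx) (K0 : 'M[F]_(nu, nx)).
Hypothesis unitM : R + B^T *m P *m B \in unitmx.
Hypothesis ric : riccati_solution A B Q R S P.
Local Notation Ac := (A + B *m K0).
Local Notation W := (block_mx Q S^T S R).
Local Notation Kstar := (lqr_gain A B R S P).
Local Notation As := (A + B *m Kstar).
Local Notation Kbar := (Kstar - K0).

(** Lower block of W [1; Kstar] = [P; 0] - [A B]^T P As; [riccati_stationary] is the upper block. *)
Lemma lqr_gain_stationary : S + R *m Kstar = - (B^T *m P *m As).
Proof.
rewrite mulmxDr !mulmxA; apply/eqP; rewrite -addr_eq0.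
have -> : S + R *m Kstar + (B^T *m P *m A + B^T *m P *m B *m Kstar) =
    (R + B^T *m P *m B) *m Kstar + (B^T *m P *m A + S).
  by rewrite mulmxDl addrACA [RHS]addrC [S + _]addrC !addrA; congr (_ + _);
     rewrite [RHS]addrC !addrA.
by rewrite /lqr_gain mulmxN mulmxA mulmxV// mul1mx addNr.
Qed.

Lemma riccati_stationary : Q + S^T *m Kstar = P - A^T *m P *m As.
Proof.
have ricK : P = A^T *m P *m A + (A^T *m P *m B + S^T) *m Kstar + Q.
  by rewrite {1}ric /lqr_gain mulmxN !mulmxA.
apply/eqP; rewrite eq_sym subr_eq; apply/eqP; rewrite [LHS]ricK.
rewrite mulmxDr mulmxDl !mulmxA [RHS]addrC -!addrA; congr (_ + (_ + _)).
exact: addrC.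
Qed.

(** A polarized Bellman equation: paired with an optimal pair, an arbitrary pair costs the decrease
    of the P-form over one step. *)
Lemma bilin_pair_optimal (x y : 'cV[F]_nx) (u : 'cV[F]_nu) :
  bilin (closed_loop_pair K0 x u) W (closed_loop_pair K0 y (Kbar *m y)) =
  bilin x P y - bilin (Ac *m x + B *m u) P (As *m y).
Proof.
have -> : closed_loop_pair K0 y (Kbar *m y) = col_mx 1%:M Kstar *m y.
  by rewrite /closed_loop_pair mul_col_mx mul1mx -mulmxDl addrC subrK.
rewrite bilinMr mul_block_col !mulmx1 riccati_stationary lqr_gain_stationary.
have -> : Ac *m x + B *m u = A *m x + B *m (K0 *m x + u).
  by rewrite mulmxDl mulmxDr !mulmxA addrA.
rewrite /closed_loop_pair bilinDl !bilinMl !bilinMr /bilin tr_col_mx mul_row_col.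
by rewrite mulmxDl mulmxBr [_^T *m - _]mulmxN mulmxBl [- _ *m y]mulNmx !mxE opprD addrA.
Qed.

End Riccati.

(** * Lower bound on the stage cost by its input part *)

Section SchurComplement.
Context {F : realType} {nx nu : nat}.
Variables (Q : 'M[F]_nx) (R : 'M[F]_nu) (S : 'M[F]_(nu, nx)) (K0 : 'M[F]_(nu, nx)).
Hypothesis symQ : Q^T = Q.
Hypothesis symR : R^T = R.
Hypothesis posW : posdefmx (block_mx Q S^T S R).
Local Notation W := (block_mx Q S^T S R).
Local Notation pair := (closed_loop_pair K0).
Local Notation Sbar := (R *m K0 + S).
Local Notation Qbar := (Q + K0^T *m S + S^T *m K0 + K0^T *m R *m K0).
Local Notation schur := (R - Sbar *m invmx Qbar *m Sbar^T).

Lemma closed_loop_weight_posdef : posdefmx Qbar.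
Proof.
split.
  rewrite !linearD /= !trmx_mul !trmxK symQ symR mulmxA.
  by rewrite -!addrA; congr (_ + _); rewrite addrCA.
move=> x x0; have := posW.2 (pair x 0).
rewrite bilin_pair// !bilin0l !addr0; apply.
by apply: contraNneq x0 => /(congr1 usubmx); rewrite col_mxKu linear0 => ->.
Qed.

Let symQbar : Qbar^T = Qbar. Proof. by case: closed_loop_weight_posdef. Qed.
Let unitQbar : Qbar \in unitmx. Proof. exact: posdefmx_unit closed_loop_weight_posdef. Qed.

(** Completing the square in the state. *)
Lemma bilin_pair_schur x u :
  bilin (pair x u) W (pair x u) =
  bilin (x + invmx Qbar *m (Sbar^T *m u)) Qbar (x + invmx Qbar *m (Sbar^T *m u))
  + bilin u schur u.
Proof.
rewrite bilin_pair//; move: symQbar unitQbar.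
set Qb := Qbar; set Sb := Sbar => symQb uQb.
rewrite bilinMB !bilinDl !bilinDr !bilinMl !bilinMr.
rewrite trmx_inv trmxK symQb !mulmxA.
rewrite mulmxV// mul1mx -[Sb *m invmx Qb *m Qb]mulmxA mulVmx// mulmx1.
by rewrite [bilin x Sb^T u]bilin_tr; ring.
Qed.

Lemma schur_complement_posdef : posdefmx schur.
Proof.
split.
  by rewrite linearB /= !trmx_mul trmx_inv trmxK symQbar symR mulmxA.
move=> u u0; pose x := - (invmx Qbar *m (Sbar^T *m u)).
have := posW.2 (pair x u); rewrite bilin_pair_schur /x addNr bilin0l add0r.
apply; rewrite -/x; apply/eqP => xu0.
have x0 : x = 0 by have := congr1 usubmx xu0; rewrite col_mxKu linear0.
have := congr1 dsubmx xu0; rewrite col_mxKd linear0 x0 mulmx0 add0r.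
by move/eqP; rewrite (negbTE u0).
Qed.

Lemma bilin_pair_ge x u : (0 < nu)%N ->
  lambda_min schur * l2norm u ^+ 2 <= bilin (pair x u) W (pair x u).
Proof.
move=> nu0; have [_ h] := lambda_min_spec nu0 schur_complement_posdef.1.
rewrite bilin_pair_schur; apply: le_trans (h u) _; rewrite lerDr.
set z := x + _; have [->|z0] := eqVneq z 0; first by rewrite bilin0l.
exact/ltW/closed_loop_weight_posdef.2.
Qed.

End SchurComplement.

(** * Truncation error of the optimal filter *)
Section ErrorBound.
Context {F : realType} {nx nu : nat}.
Variables (A : 'M[F]_nx) (B : 'M[F]_(nx, nu)).
Variables (Q : 'M[F]_nx) (R : 'M[F]_nu) (S : 'M[F]_(nu, nx)).
Variables (K0 Kstar : 'M[F]_(nu, nx)) (tau q : F) (H : nat).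
Local Notation Ac := (A + B *m K0).
Local Notation As := (A + B *m Kstar).
Local Notation Kbar := (Kstar - K0).
Local Notation W := (block_mx Q S^T S R).
Local Notation Sbar := (R *m K0 + S).
Local Notation Qbar := (Q + K0^T *m S + S^T *m K0 + K0^T *m R *m K0).
Hypothesis symR : R^T = R.
Hypothesis (tau_ge1 : 1 <= tau) (q_gt0 : 0 < q) (q_lt1 : q < 1).
Hypothesis Ac_stable : pow_stable tau q Ac.
Hypothesis As_stable : pow_stable tau q As.
Local Notation traj := (traj A B K0).

Let q0 : 0 <= q. Proof. exact: ltW. Qed.
Let q1 : q <= 1. Proof. exact: ltW. Qed.
Let tau0 : 0 <= tau. Proof. exact: le_trans ler01 tau_ge1. Qed.
Let r01 : 0 <= q ^+ 2 < 1. Proof. by rewrite sqr_ge0 expr_lt1. Qed.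

Variables (v : 'cV[F]_nx) (D : nat -> 'cV[F]_nu).
Hypothesis v_le1 : l2norm v <= 1.
Hypothesis D0 : forall k, (H <= k)%N -> D k = 0.

Definition optimal_input k := Kbar *m (As ^+ k *m v).

Definition tail_input k := if (k < H)%N then 0 else optimal_input k.

Local Notation E := tail_input.
Local Notation d := (Num.sqrt (\sum_(k < H) l2norm (D k) ^+ 2)).
Local Notation b := (spectral_norm B).
Local Notation kappa := (spectral_norm Kbar).

Lemma optimal_input_le k : l2norm (optimal_input k) <= kappa * (tau * q ^+ k).
Proof.
apply: le_trans (l2norm_mulmx _ _) _; rewrite ler_wpM2l ?spectral_norm_ge0//.
apply: le_trans (As_stable k v) _.
by rewrite ler_piMr// mulr_ge0 ?exprn_ge0.
Qed.

(** D stops at H, leaving a convolution with the weights q^(H-k-1). Cauchy-Schwarz pairs them with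
    [d], the quantity that the Hessian controls, and produces the half power of 1 - q^2. *)
Lemma resp_head_le m : l2norm (resp Ac B 0 D (H + m)) <=
  q ^+ m * (tau * b * (Num.sqrt (1 - q ^+ 2)^-1 * d)).
Proof.
rewrite resp_free// resp_sum mulmx0 add0r mulmx_sumr.
apply: le_trans (l2norm_sum _ _ _) _.
apply: (@le_trans _ _ (\sum_(k < H) q ^+ m * (tau * b) * (q ^+ (H - k.+1) * l2norm (D k)))).
  apply: ler_sum => k _.
  rewrite [_ *m (_ *m (B *m _))]mulmxA -[Ac ^+ m *m _]/(Ac ^+ m * Ac ^+ _) -exprD.
  apply: le_trans (Ac_stable _ _) _.
  have h := l2norm_mulmx B (D k).
  apply: (@le_trans _ _ (tau * q ^+ (m + (H - k.+1)) * (b * l2norm (D k)))).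
    by rewrite ler_wpM2l// mulr_ge0 ?exprn_ge0.
  by rewrite exprD le_eqVlt; apply/orP; left; apply/eqP; ring.
rewrite -mulr_sumr -mulrA ler_wpM2l ?exprn_ge0// ler_wpM2l ?mulr_ge0 ?spectral_norm_ge0//.
apply: le_trans (sum_cauchy_schwarz _ _) _.
rewrite ler_wpM2r ?sqrtr_ge0// ler_wsqrtr//.
rewrite (reindex_inj rev_ord_inj) /=.
apply: le_trans (sum_expr_le H r01); apply: ler_sum => k _.
have -> : (H - (H - k.+1).+1 = k)%N by rewrite subnSK// subKn// ltnW.
by rewrite -!exprM mulnC.
Qed.

(** E starts at H, so m inputs have acted; the k-th has size q^(H+k) and has since decayed by
    q^(m-k-1), a product independent of k. At m = 0 the factor [m%:R] makes the truncated [m.-1]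
    harmless. *)
Lemma resp_tail_le m : l2norm (resp Ac B 0 E (H + m)) <=
  m%:R * (tau ^+ 2 * b * kappa * q ^+ (H + m.-1)).
Proof.
rewrite resp_shift resp0_eq0; last by move=> i iH; rewrite /tail_input iH.
rewrite resp_sum mulmx0 add0r; apply: le_trans (l2norm_sum _ _ _) _.
rewrite mulr_natl -[X in _ *+ X]card_ord -sumr_const; apply: ler_sum => k _.
rewrite /tail_input ltnNge leq_addr /=.
apply: le_trans (Ac_stable _ _) _.
apply: (@le_trans _ _ (tau * q ^+ (m - k.+1) * (b * (kappa * (tau * q ^+ (H + k)))))).
  rewrite ler_wpM2l ?mulr_ge0 ?exprn_ge0//.
  apply: le_trans (l2norm_mulmx _ _) _.
  by rewrite ler_wpM2l ?spectral_norm_ge0// optimal_input_le.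
have -> : (H + m.-1 = (m - k.+1) + (H + k))%N.
  by rewrite addnCA subnS predn_sub subnK// -ltnS prednK// (leq_trans _ (ltn_ord k)).
by rewrite [q ^+ (_ - _ + _)]exprD le_eqVlt; apply/orP; left; apply/eqP; ring.
Qed.

Lemma cross_term_head j : (j < H)%N -> bilin (traj 0 D j) W (traj 0 E j) = 0.
Proof.
move=> jH; rewrite {2}/traj resp0_eq0 => [|i ij]; last first.
  by rewrite /tail_input (ltn_trans ij jH).
by rewrite /tail_input jH pair0 bilin0r.
Qed.

(** After H the input D is zero, so of the four terms of [bilin_pair] only state against state and E
    against the state of D remain. *)
Lemma cross_term_tail m : bilin (traj 0 D (H + m)) W (traj 0 E (H + m)) <=
  (tau ^+ 3 * (b ^+ 2 * kappa * spectral_norm Qbar + b * kappa * spectral_norm Sbar)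
     * q ^+ H * (Num.sqrt (1 - q ^+ 2)^-1 * d))
  * (m%:R * (q ^+ 2) ^+ m.-1 + (q ^+ 2) ^+ m).
Proof.
rewrite bilin_pair// D0 ?leq_addr// !bilin0l addr0 addr0.
set xD := resp _ _ 0 D _; set xE := resp _ _ 0 E _.
have nQ := spectral_norm_ge0 Qbar; have nS := spectral_norm_ge0 Sbar.
have nb := spectral_norm_ge0 B; have nk := spectral_norm_ge0 Kbar.
set s := Num.sqrt _ * d.
have s0 : 0 <= s by rewrite mulr_ge0 ?sqrtr_ge0.
have eE : E (H + m) = optimal_input (H + m) by rewrite /tail_input ltnNge leq_addr.
have xDle : l2norm xD <= q ^+ m * (tau * b * s) := resp_head_le m.
have xEle : l2norm xE <= m%:R * (tau ^+ 2 * b * kappa * q ^+ (H + m.-1)) := resp_tail_le m.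
have term1 : bilin xD Qbar xE <=
    tau ^+ 3 * (b ^+ 2 * kappa * spectral_norm Qbar) * q ^+ H * s * (m%:R * (q ^+ 2) ^+ m.-1).
  apply: le_trans (ler_norm _) _; apply: le_trans (bilin_le _ _ _) _.
  apply: (@le_trans _ _ ((q ^+ m * (tau * b * s)) *
     (spectral_norm Qbar * (m%:R * (tau ^+ 2 * b * kappa * q ^+ (H + m.-1)))))).
    by apply: ler_pM; rewrite ?mulr_ge0 ?l2norm_ge0// ler_wpM2l.
  have -> : q ^+ m * (tau * b * s) *
     (spectral_norm Qbar * (m%:R * (tau ^+ 2 * b * kappa * q ^+ (H + m.-1)))) =
     (tau ^+ 3 * (b ^+ 2 * kappa * spectral_norm Qbar) * q ^+ H * s)
      * (m%:R * (q ^+ m * q ^+ m.-1)).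
    rewrite [q ^+ (H + _)]exprD. ring.
  rewrite ler_wpM2l ?mulr_ge0 ?exprn_ge0//.
  (* One factor q <= 1 is given up to reach a power of q^2. *)
  by rewrite ler_wpM2l// -exprM -exprD ler_wiXn2l// mul2n -addnn leq_add2r leq_pred.
have term2 : bilin (E (H + m)) Sbar xD <=
    tau ^+ 3 * (b * kappa * spectral_norm Sbar) * q ^+ H * s * (q ^+ 2) ^+ m.
  apply: le_trans (ler_norm _) _; apply: le_trans (bilin_le _ _ _) _.
  apply: (@le_trans _ _ (kappa * (tau * q ^+ (H + m)) *
     (spectral_norm Sbar * (q ^+ m * (tau * b * s))))).
    apply: ler_pM; rewrite ?mulr_ge0 ?l2norm_ge0//; first by rewrite eE optimal_input_le.
    by rewrite ler_wpM2l.
  have -> : kappa * (tau * q ^+ (H + m)) * (spectral_norm Sbar * (q ^+ m * (tau * b * s))) =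
     tau ^+ 2 * (b * kappa * spectral_norm Sbar * q ^+ H * s * (q ^+ 2) ^+ m).
    by rewrite -exprM mulnC exprM [q ^+ (H + _)]exprD; ring.
  have -> : tau ^+ 3 * (b * kappa * spectral_norm Sbar) * q ^+ H * s * (q ^+ 2) ^+ m =
     tau ^+ 3 * (b * kappa * spectral_norm Sbar * q ^+ H * s * (q ^+ 2) ^+ m) by ring.
  (* This term carries only tau^2, raised to tau^3 to match the other one. *)
  by rewrite ler_wpM2r ?ler_weXn2l// !mulr_ge0 ?exprn_ge0.
have u0 : 0 <= tau ^+ 3 * q ^+ H * s by rewrite !mulr_ge0 ?exprn_ge0.
have a0 : 0 <= b ^+ 2 * kappa * spectral_norm Qbar by rewrite !mulr_ge0 ?exprn_ge0.
have c0 : 0 <= b * kappa * spectral_norm Sbar by rewrite !mulr_ge0.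
have f0 : 0 <= m%:R * (q ^+ 2) ^+ m.-1 by rewrite !mulr_ge0 ?exprn_ge0.
have g0 : 0 <= (q ^+ 2) ^+ m by rewrite !exprn_ge0.
apply: le_trans (lerD term1 term2) _.
set f := m%:R * _ in f0 *; set g := _ ^+ m in g0 *.
set a := b ^+ 2 * _ * _ in a0 *; set c := b * _ * _ in c0 *.
(* The bound a f + c g is relaxed to (a + c) (f + g) to obtain a single factor in front of the sum
   over m. *)
rewrite -subr_ge0.
have -> : tau ^+ 3 * (a + c) * q ^+ H * s * (f + g) -
   (tau ^+ 3 * a * q ^+ H * s * f + tau ^+ 3 * c * q ^+ H * s * g) =
   (tau ^+ 3 * q ^+ H * s) * (a * g + c * f) by ring.
by rewrite mulr_ge0// addr_ge0// mulr_ge0.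
Qed.

Lemma cross_sum_le M :
  series (fun j => bilin (traj 0 D j) W (traj 0 E j)) (H + M)%N <=
  (tau ^+ 3 * (b ^+ 2 * kappa * spectral_norm Qbar + b * kappa * spectral_norm Sbar)
     * q ^+ H * (Num.sqrt (1 - q ^+ 2)^-1 * d)) * (2 * (1 - q ^+ 2) ^- 2).
Proof.
rewrite /series /= (big_cat_nat (n := H)) ?leq_addr//= big_nat_cond big1 ?add0r; last first.
  by move=> j /andP[/andP[_ jH] _]; exact: cross_term_head.
rewrite -{1}[H]add0n big_addn addKn big_mkord.
have nQ := spectral_norm_ge0 Qbar; have nS := spectral_norm_ge0 Sbar.
have nb := spectral_norm_ge0 B; have nk := spectral_norm_ge0 Kbar.
set C := tau ^+ 3 * _ * _ * _.
have C0 : 0 <= C by rewrite /C !mulr_ge0 ?addr_ge0 ?mulr_ge0 ?exprn_ge0 ?sqrtr_ge0.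
apply: (@le_trans _ _ (\sum_(m < M) C * (m%:R * (q ^+ 2) ^+ m.-1 + (q ^+ 2) ^+ m))).
  by apply: ler_sum => m _; rewrite [(m + H)%N]addnC; exact: cross_term_tail.
(* The 2 is split between the two sums; the plain geometric one is even at most (1 - q^2)^(-1),
   weakened to the common power. *)
rewrite -mulr_sumr ler_wpM2l// big_split /= mulr_natl mulr2n.
apply: lerD; first exact: sum_mulrn_expr_le.
apply: le_trans (sum_expr_le M r01) _.
have /andP[r0 r1] := r01.
rewrite lef_pV2 ?posrE ?exprn_gt0 ?subr_gt0// expr2 ler_piMr ?subr_ge0 ?(ltW r1)//.
by rewrite gerBl.
Qed.

End ErrorBound.

(** * Comparison of the two minimizers *)

Section OptimalFilter.
Context {F : realType} {nx nu : nat}.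
Variables (A : 'M[F]_nx) (B : 'M[F]_(nx, nu)).
Variables (Q : 'M[F]_nx) (R : 'M[F]_nu) (S : 'M[F]_(nu, nx)).
Variables (P : 'M[F]_nx) (K0 : 'M[F]_(nu, nx)) (tau q : F).
Local Notation Kstar := (lqr_gain A B R S P).
Local Notation Ac := (A + B *m K0).
Local Notation As := (A + B *m Kstar).
Local Notation Kbar := (Kstar - K0).
Local Notation W := (block_mx Q S^T S R).
Local Notation Sbar := (R *m K0 + S).
Local Notation Qbar := (Q + K0^T *m S + S^T *m K0 + K0^T *m R *m K0).
Local Notation schur := (R - Sbar *m invmx Qbar *m Sbar^T).
Local Notation traj := (traj A B K0).
Local Notation optimal := (optimal_input A B K0 Kstar).
Hypothesis nu_gt0 : (0 < nu)%N.
Hypothesis symQ : Q^T = Q.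
Hypothesis posR : posdefmx R.
Hypothesis posW : posdefmx (block_mx Q S^T S R).
Hypothesis psdP : possemidefmx P.
Hypothesis ric : riccati_solution A B Q R S P.
Hypothesis (tau_ge1 : 1 <= tau) (q_gt0 : 0 < q) (q_lt1 : q < 1).
Hypothesis Ac_stable : pow_stable tau q Ac.
Hypothesis As_stable : pow_stable tau q As.

Let symR : R^T = R. Proof. by case: posR. Qed.

Lemma riccati_weight_unit : R + B^T *m P *m B \in unitmx.
Proof.
apply: posdefmx_unit; split.
  by rewrite linearD /= symR !trmx_mul trmxK psdP.1 mulmxA.
move=> u u0; rewrite bilinMD ltr_pwDl ?posR.2//.
by rewrite -mulmxA -bilinMl -bilinMr psdP.2.
Qed.

(** The residual gain [Kbar] on top of [K0] restores the optimal loop: Ac + B Kbar = As. *)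
Lemma resp_optimal v j : resp Ac B v (optimal v) j = As ^+ j *m v.
Proof.
elim: j => [|j IH] /=; first by rewrite expr0 mul1mx.
rewrite IH /optimal_input exprS -mulmxA; move: (As ^+ j *m v) => y.
by rewrite [B *m (_ *m y)]mulmxA -mulmxDl -addrA -mulmxDr subrKC.
Qed.

(* The cross terms telescope along the Riccati equation. *)
Lemma optimal_orthogonal H (v : 'cV[F]_nx) (D : nat -> 'cV[F]_nu) :
  (forall k, (H <= k)%N -> D k = 0) ->
  series (fun j => bilin (traj 0 D j) W (traj v (optimal v) j)) @ \oo --> (0 : F).
Proof.
move=> D0; pose f j := bilin (resp Ac B 0 D j) P (As ^+ j *m v).
have -> : series (fun j => bilin (traj 0 D j) W (traj v (optimal v) j)) = (fun n => - f n).
  apply/funext => n; rewrite /series /=.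
  rewrite (eq_bigr (fun j => - (f j.+1 - f j))) => [|j _].
    by rewrite sumrN telescope_sumr// /f bilin0l subr0.
  rewrite /traj resp_optimal bilin_pair_optimal//; last exact: riccati_weight_unit.
  by rewrite opprB /f exprS -mulmxA.
(* The sum starts from 0 because the response to D does; the remaining boundary term is a product of
   two decaying states. *)
rewrite -oppr0; apply: cvgN.
have [C C0 hC] := resp_bound tau_ge1 q_gt0 q_lt1 Ac_stable 0 D0.
have hv j : l2norm (As ^+ j *m v) <= (tau * l2norm v) * q ^+ j.
  by rewrite mulrAC; exact: As_stable.
have q01 : 0 <= q ^+ 2 < 1 by rewrite sqr_ge0 expr_lt1// ltW.
exact: cvgn0_geometric_bound q01 (bilin_geometric_bound P C0 hC hv).
Qed.

Lemma optimal_filter_close H (H_gt0 : (0 < H)%N) (L : 'I_H -> 'M[F]_(nu, nx)) :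
  (forall L' : 'I_H -> 'M[F]_(nu, nx),
     filter_cost A B Q R S K0 L <= filter_cost A B Q R S K0 L') ->
  spectral_norm (Kbar - L (Ordinal H_gt0)) <=
  (tau ^+ 3 * (spectral_norm B ^+ 2 * spectral_norm Kbar * spectral_norm Qbar
      + spectral_norm B * spectral_norm Kbar * spectral_norm Sbar)
    * q ^+ H * Num.sqrt (1 - q ^+ 2)^-1) * (2 * (1 - q ^+ 2) ^- 2) / lambda_min schur.
Proof.
move=> Lmin; apply: spectral_norm_le => v v1.
have lam0 : 0 < lambda_min schur.
  by apply: lambda_min_gt0 => //; exact: (schur_complement_posdef K0 symQ symR posW).
(* L* - Loptimal = D - E with D the error on the first H coefficients and E the
   discarded tail; both first-order conditions make D orthogonal to D - E. *)
pose D j := if (j < H)%N then extend L j *m v - optimal v j else 0.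
have D0 k : (H <= k)%N -> D k = 0 by move=> Hk; rewrite /D ltnNge Hk.
pose E := tail_input A B K0 Kstar H v.
set d := Num.sqrt (\sum_(k < H) l2norm (D k) ^+ 2).
have d0 : 0 <= d by exact: sqrtr_ge0.
have d2 : d ^+ 2 = \sum_(k < H) l2norm (D k) ^+ 2.
  by rewrite sqr_sqrtr// sumr_ge0// => k _; exact: sqr_ge0.
have dD : l2norm (D 0) <= d.
  rewrite -ler_sqr ?nnegrE ?l2norm_ge0// d2 (bigD1 (Ordinal H_gt0))//= lerDl.
  by rewrite sumr_ge0// => k _; exact: sqr_ge0.
have -> : (Kbar - L (Ordinal H_gt0)) *m v = - D 0.
  rewrite /D H_gt0 -[0]/(val (Ordinal H_gt0)) extend_lt /optimal_input expr0 mul1mx.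
  by rewrite opprB mulmxBl.
rewrite l2normN; apply: le_trans dD _; rewrite ler_pdivlMr//.
set C := tau ^+ 3 * _ * _ * _.
pose DE j := bilin (traj 0 D j) W (traj 0 D j) - bilin (traj 0 D j) W (traj 0 E j).
have cvg0 : series DE @ \oo --> (0 : F).
  have -> : series DE =
      series (fun j => bilin (traj 0 D j) W (traj v (fun k => extend L k *m v) j))
      \- series (fun j => bilin (traj 0 D j) W (traj v (optimal v) j)).
    apply/funext => n /=; rewrite /series /= -sumrB; apply: eq_bigr => j _.
    rewrite /DE.
    have -> : traj v (fun k => extend L k *m v) j =
        traj v (optimal v) j + (traj 0 D j + -1 *: traj 0 E j).
      rewrite -trajZ scaler0 -!trajD !addr0; apply: eq_traj => i.
      rewrite /D /E /tail_input; case: ltnP => iH.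
        by rewrite scaler0 addr0 addrC subrK.
      by rewrite extend_ge// mul0mx add0r scaleN1r subrr.
    by rewrite !bilinDr bilinZr; ring.
  rewrite -[X in _ --> X]subr0; apply: cvgB.
    exact: (filter_cost_first_order symQ symR tau_ge1 q_gt0 q_lt1 Ac_stable Lmin v D0).
  exact: optimal_orthogonal D0.
(* Bounding the partial sums of the difference requires a limit for [DE] alone, not for its two
   halves. In the first half only the first H stages have nonzero input. *)
have key n : (H <= n)%N -> lambda_min schur * d ^+ 2 - C * d * (2 * (1 - q ^+ 2) ^- 2) <= series DE n.
  move=> Hn; rewrite /series /= sumrB lerB//.
    rewrite d2 mulr_sumr big_mkord (big_ord_widen n (fun k => lambda_min schur * l2norm (D k) ^+ 2))//.
    rewrite big_mkcond /=; apply: ler_sum => k _.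
    apply: (@le_trans _ _ (lambda_min schur * l2norm (D k) ^+ 2)); last exact: bilin_pair_ge.
    case: ifP => // /negbT; rewrite -leqNgt => Hk.
    by rewrite D0// l2norm0 expr0n mulr0.
  have := cross_sum_le Q S symR tau_ge1 q_gt0 q_lt1 Ac_stable As_stable v1 D0 (n - H)%N.
  by rewrite subnKC// -/d [_ * (_ * d)]mulrA.
have : lambda_min schur * d ^+ 2 - C * d * (2 * (1 - q ^+ 2) ^- 2) <= 0.
  rewrite -(cvg_lim _ cvg0)//; apply: limr_ge; first by apply/cvg_ex; exists 0.
  by exists H => // n; exact: key.
(* One factor [d] is to be cancelled; if it is 0, nonnegativity of the bound is enough. *)
have [->|dn0] := eqVneq d 0.
  move=> _; rewrite mul0r; have /andP[r0 r1] : 0 <= q ^+ 2 < 1.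
    by rewrite sqr_ge0 expr_lt1// ltW.
  have C0 : 0 <= C.
    have tau0 : 0 <= tau := le_trans ler01 tau_ge1.
    rewrite /C !mulr_ge0 ?sqrtr_ge0 ?exprn_ge0 ?(ltW q_gt0)//.
    by rewrite addr_ge0// !mulr_ge0 ?exprn_ge0 ?spectral_norm_ge0.
  by rewrite mulr_ge0// mulr_ge0// invr_ge0 exprn_ge0// subr_ge0 ltW.
rewrite subr_le0 => h; rewrite -(ler_pM2r (x := d)) ?lt_def ?dn0//.
by apply: le_trans (_ : lambda_min schur * d ^+ 2 <= _); rewrite ?expr2; lra.
Qed.

End OptimalFilter.

(** * Expected cost under white noise *)
Section QuadraticMean.
Context {d : measure_display} {T : measurableType d} {F : realType}.
Variables (Pr : probability T F) (I : finType) (X : I -> T -> F) (sig : F).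
Hypothesis X_mean : forall p, has_mean Pr (X p) 0.
Hypothesis X_cov : forall p r, has_mean Pr (fun om => X p om * X r om) (sig * (p == r)%:R).

Lemma has_mean_affine_mul (a b : F) (c e : I -> F) :
  has_mean Pr (fun om => (a + \sum_p c p * X p om) * (b + \sum_p e p * X p om))
    (a * b + sig * \sum_p c p * e p).
Proof.
have -> : (fun om => (a + \sum_p c p * X p om) * (b + \sum_p e p * X p om)) =
  (fun om => a * b + (\sum_p (a * e p + b * c p) * X p om
     + \sum_p \sum_r (c p * e r) * (X p om * X r om))).
  apply/funext => om.
  have -> : \sum_p \sum_r (c p * e r) * (X p om * X r om) =
      (\sum_p c p * X p om) * (\sum_p e p * X p om).
    rewrite mulr_suml; apply: eq_bigr => p _; rewrite mulr_sumr.
    by apply: eq_bigr => r _; ring.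
  have -> : \sum_p (a * e p + b * c p) * X p om =
      a * (\sum_p e p * X p om) + b * (\sum_p c p * X p om).
    by rewrite !mulr_sumr -big_split /=; apply: eq_bigr => p _; ring.
  by ring.
have -> : a * b + sig * \sum_p c p * e p =
  a * b + (\sum_p (a * e p + b * c p) * 0 + \sum_p \sum_r (c p * e r) * (sig * (p == r)%:R)).
  congr (_ + _); rewrite [X in X + _]big1 ?add0r => [|p _]; last by rewrite mulr0.
  rewrite mulr_sumr; apply: eq_bigr => p _.
  rewrite (bigD1 p)//= big1 ?addr0 => [|r rp].
    by rewrite eqxx mulr1 mulrC.
  by rewrite eq_sym (negbTE rp) !mulr0.
apply: has_meanD; first exact: has_mean_cst.
apply: has_meanD; first by apply: has_mean_sum => p _; exact: has_meanZ.
by apply: has_mean_sum => p _; apply: has_mean_sum => r _; exact: has_meanZ.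
Qed.

End QuadraticMean.

Section WhiteNoise.
Context {d : measure_display} {T : measurableType d} {F : realType} {n : nat}.
Variables (Pr : probability T F) (w : nat -> 'I_n -> {RV Pr >-> F}).
Hypothesis white : gaussian_white_noise w.

Lemma rv_borel (X : {RV Pr >-> F}) :
  exists X' : {mfun T >-> measurableTypeR F}, (X' : T -> F) = X.
Proof.
have mX : measurable_fun setT (X : T -> measurableTypeR F).
  by move=> mD A mA; exact: (@measurable_funPT _ _ _ _ X mD A mA).
pose X' : {mfun T >-> measurableTypeR F} :=
  HB.pack (X : T -> measurableTypeR F) (isMeasurableFun.Build _ _ _ _ _ mX).
by exists X'.
Qed.

(** Distinct times are separated by the independence of the vectors, equal times by that of the
    coordinates. *)
Lemma white_noise_indep t s i j (V V' : set F) : (t, i) != (s, j) ->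
  measurable V -> measurable V' ->
  (Pr (w t i @^-1` V `&` w s j @^-1` V') = Pr (w t i @^-1` V) * Pr (w s j @^-1` V'))%E.
Proof.
move=> ne mV mV'.
have gen t' i' (A : set F) : measurable A -> generated_by (w t' i') (w t' i' @^-1` A).
  by move=> mA; exists A => //; rewrite setTI.
have [ts|ts] := eqVneq t s; last first.
  apply: (mutually_independent2 white.2 ts).
    by apply: sub_sigma_algebra; exists i => //; exact: gen.
  by apply: sub_sigma_algebra; exists j => //; exact: gen.
subst s; have ij : i != j by apply: contraNneq ne => ->.
exact: (mutually_independent2 (white.1 t).2 ij (gen _ _ _ mV) (gen _ _ _ mV')).
Qed.

Lemma white_noise_mean t i : has_mean Pr (w t i) 0.
Proof.
have [X XE] := rv_borel (w t i); rewrite -XE.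
apply: standard_normal_has_mean0 => V mV.
by rewrite -[RHS]((white.1 t).1 i V mV) /distribution /pushforward -XE.
Qed.

Lemma white_noise_cov t i s j :
  has_mean Pr (fun om => w t i om * w s j om) (normal_var * ((t == s) && (i == j))%:R).
Proof.
have [X XE] := rv_borel (w t i); have [Y YE] := rv_borel (w s j).
have NX : standard_normal Pr X.
  by move=> V mV; rewrite -[RHS]((white.1 t).1 i V mV) /distribution /pushforward -XE.
have NY : standard_normal Pr Y.
  by move=> V mV; rewrite -[RHS]((white.1 s).1 j V mV) /distribution /pushforward -YE.
rewrite -XE -YE -xpair_eqE.
have [[ts ij]|ne] := eqVneq (t, i) (s, j).
  rewrite mulr1; have -> : (Y : T -> F) = X by rewrite YE XE ts ij.
  exact: standard_normal_has_mean_sqr.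
rewrite mulr0; apply: independent_standard_normal_has_mean => // V V' mV mV'.
by have := white_noise_indep ne mV mV'; rewrite -XE -YE.
Qed.

Lemma white_noise_quadratic_mean m (W : 'M[F]_m) (a : 'cV[F]_m) N (M : 'I_N -> 'M[F]_(m, n)) :
  has_mean Pr (fun om => bilin (a + \sum_s M s *m noise_path w om s) W
                               (a + \sum_s M s *m noise_path w om s))
    (bilin a W a + normal_var * \sum_s \tr ((M s)^T *m W *m M s)).
Proof.
pose X (p : 'I_N * 'I_n) := w p.1 p.2.
pose z om := a + \sum_s M s *m noise_path w om s.
have zE om k : z om k 0 = a k 0 + \sum_p M p.1 k p.2 * X p om.
  rewrite mxE summxE; congr (_ + _).
  rewrite -(pair_bigA _ (fun s i => M s k i * w s i om)) /=.
  by apply: eq_bigr => s _; rewrite mxE; apply: eq_bigr => i _; rewrite mxE.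
have Xm p : has_mean Pr (X p) 0 by exact: white_noise_mean.
have Xc p r : has_mean Pr (fun om => X p om * X r om) (normal_var * (p == r)%:R).
  by case: p r => [s i] [s' i']; rewrite xpair_eqE; exact: white_noise_cov.
have -> : (fun om => bilin (z om) W (z om)) = (fun om => \sum_k \sum_l W k l *
   ((a k 0 + \sum_p M p.1 k p.2 * X p om) * (a l 0 + \sum_p M p.1 l p.2 * X p om))).
  apply/funext => om; rewrite bilinE; apply: eq_bigr => k _; apply: eq_bigr => l _.
  by rewrite !zE; ring.
have -> : bilin a W a + normal_var * \sum_s \tr ((M s)^T *m W *m M s) =
   \sum_k \sum_l W k l * (a k 0 * a l 0 + normal_var * \sum_p M p.1 k p.2 * M p.1 l p.2).
  have -> : \sum_s \tr ((M s)^T *m W *m M s) =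
      \sum_k \sum_l W k l * \sum_p M p.1 k p.2 * M p.1 l p.2.
    under [RHS]eq_bigr do under eq_bigr do rewrite mulr_sumr.
    under [RHS]eq_bigr do rewrite exchange_big /=.
    rewrite [RHS]exchange_big /= -(pair_bigA _ (fun s i => \sum_k \sum_l W k l * (M s k i * M s l i))) /=.
    apply: eq_bigr => s _; rewrite /mxtrace; apply: eq_bigr => i _.
    rewrite mxE exchange_big /=; apply: eq_bigr => l _; rewrite mxE mulr_suml.
    by apply: eq_bigr => k _; rewrite mxE; ring.
  rewrite bilinE mulr_sumr -big_split /=; apply: eq_bigr => k _.
  by rewrite mulr_sumr -big_split /=; apply: eq_bigr => l _; ring.
apply: has_mean_sum => k _; apply: has_mean_sum => l _; apply: has_meanZ.
exact: has_mean_affine_mul.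
Qed.

End WhiteNoise.

(** * Reduction of the stochastic cost to [filter_cost] *)

Section LqrCost.
Context {F : realType} {nx nu : nat}.
Variables (A : 'M[F]_nx) (B : 'M[F]_(nx, nu)).
Variables (Q : 'M[F]_nx) (R : 'M[F]_nu) (S : 'M[F]_(nu, nx)).
Variables (K0 : 'M[F]_(nu, nx)) (x0 : 'cV[F]_nx) (H : nat) (L : 'I_H -> 'M[F]_(nu, nx)).
Local Notation Ac := (A + B *m K0).
Local Notation W := (block_mx Q S^T S R).
Local Notation traj := (traj A B K0).

Section Path.
Variable w : nat -> 'cV[F]_nx.

(** The sum is re-indexed by the time s at which the noise occurred; [extend] absorbs the cut at H,
    leaving only the cut at t. *)
Lemma disturbance_inputE t :
  disturbance_input L w t = \sum_(s < t) extend L (t - s.+1) *m w s.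
Proof.
pose g k := extend L k *m w (t - k.+1)%N.
rewrite (reindex_inj rev_ord_inj) /=.
transitivity (\sum_(k < t) g k); last first.
  by apply: eq_bigr => k _; rewrite /g subnSK// subKn// ltnW.
rewrite /disturbance_input (eq_bigr (fun k : 'I_H => g k)) => [|k _]; last first.
  by rewrite /g extend_lt.
rewrite (big_ord_widen_cond (H + t) (fun k => (k < t)%N) g) ?leq_addr//.
rewrite (big_ord_widen (H + t) g) ?leq_addl// big_mkcond [RHS]big_mkcond /=.
apply: eq_bigr => k _; case: ltnP => //= kt; case: ltnP => // Hk.
by rewrite /g extend_ge// mul0mx.
Qed.

(** Superposition: w_s enters the state at time s + 1 like an initial state, and from then on the
    filter feeds in exactly L_k w_s. *)
Lemma state_respE t : state A B K0 L x0 w t =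
  resp Ac B x0 (fun=> 0) t + \sum_(s < t) resp Ac B 1%:M (extend L) (t - s.+1) *m w s.
Proof.
elim: t => [|t IH]; first by rewrite big_ord0 addr0.
rewrite /= -/(state A B K0 L x0 w t).
have -> x : A *m x + B *m (K0 *m x + disturbance_input L w t) + w t =
    Ac *m x + B *m disturbance_input L w t + w t.
  by rewrite mulmxDl mulmxDr !mulmxA addrA.
rewrite big_ord_recr /= subnn /= mul1mx addrA; congr (_ + _).
rewrite IH mulmxDr mulmx0 addr0 -addrA; congr (_ + _).
rewrite disturbance_inputE !mulmx_sumr -big_split /=; apply: eq_bigr => s _.
by rewrite subSn//= mulmxDl !mulmxA.
Qed.

Lemma state_control_trajE t :
  col_mx (state A B K0 L x0 w t) (control A B K0 L x0 w t) =
  traj x0 (fun=> 0) t + \sum_(s < t) traj 1%:M (extend L) (t - s.+1) *m w s.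
Proof.
rewrite /control -/(closed_loop_pair K0 _ _) state_respE disturbance_inputE.
rewrite -[X in closed_loop_pair K0 _ X]add0r pairD; congr (_ + _).
rewrite (eq_bigr (fun s : 'I_t => closed_loop_pair K0
  (resp Ac B 1%:M (extend L) (t - s.+1) *m w s) (extend L (t - s.+1) *m w s))).
  elim/big_rec3: _ => [|s y1 y2 y3 _ <-]; first by rewrite pair0.
  by rewrite pairD.
by move=> s _; rewrite pair_mulmx.
Qed.

End Path.

Definition stage_mean t : F :=
  bilin (traj x0 (fun=> 0) t) W (traj x0 (fun=> 0) t)
  + normal_var * \sum_(j < t) pair_cost Q R S (traj 1%:M (extend L) j) (traj 1%:M (extend L) j).

Context {d : measure_display} {T : measurableType d} (Pr : probability T F).
Variable w : nat -> 'I_nx -> {RV Pr >-> F}.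
Hypothesis white : gaussian_white_noise w.

Lemma stage_cost_mean t : has_mean Pr (fun om =>
    stage_cost Q R S (state A B K0 L x0 (noise_path w om) t)
                     (control A B K0 L x0 (noise_path w om) t)) (stage_mean t).
Proof.
under eq_fun do rewrite stage_costE state_control_trajE.
rewrite /stage_mean (reindex_inj rev_ord_inj) /=.
exact: (white_noise_quadratic_mean white).
Qed.

Variables (tau q : F).
Hypothesis (tau_ge1 : 1 <= tau) (q_gt0 : 0 < q) (q_lt1 : q < 1).
Hypothesis Ac_stable : pow_stable tau q Ac.

(** The contribution of x0 dies out by stability, and what remains is the partial sum defining
    [filter_cost]. *)
Lemma cvg_stage_mean : stage_mean @ \oo --> normal_var * filter_cost A B Q R S K0 L.
Proof.
have r01 : 0 <= q ^+ 2 < 1 by rewrite sqr_ge0 expr_lt1// ltW.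
rewrite -[X in _ --> X]add0r; apply: cvgD.
  have [C C0 hC] := @traj_bound _ _ _ A B K0 _ _ tau_ge1 q_gt0 q_lt1 Ac_stable 0 x0
    (fun=> 0) (fun _ _ => erefl).
  exact: cvgn0_geometric_bound r01 (bilin_geometric_bound W C0 hC hC).
apply: cvgMl_tmp.
have := cvgn_pair_cost (Q := Q) (R := R) (S := S) tau_ge1 q_gt0 q_lt1 Ac_stable (X0 := 1%:M) (Y0 := 1%:M)
  (@extend_ge _ _ _ _ L) (@extend_ge _ _ _ _ L).
rewrite -/(filter_cost A B Q R S K0 L) /series /=.
by under eq_fun do rewrite big_mkord.
Qed.

Lemma lqr_costE : lqr_cost A B Q R S w x0 K0 L =
  (normal_var * filter_cost A B Q R S K0 L)%:E.
Proof.
apply: cvg_lim => //.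
have -> : (fun N : nat => ((N%:R^-1)%:E *
     'E_Pr[fun om => (\sum_(t < N)
        stage_cost Q R S (state A B K0 L x0 (noise_path w om) t)
                   (control A B K0 L x0 (noise_path w om) t))%R])%E) =
   EFin \o (fun N : nat => N%:R^-1 * series stage_mean N).
  apply/funext => N /=; rewrite (has_meanE (a := \sum_(t < N) stage_mean t)).
    by rewrite /series /= big_mkord.
  by apply: has_mean_sum => t _; exact: stage_cost_mean.
apply: cvg_EFin; first by near=> N.
(* Cesaro means are indexed from one summand on; the shift skips N = 0, where the inverse takes its
   default value. *)
rewrite -cvg_shiftS; exact: cesaro cvg_stage_mean.
Unshelve. all: by end_near. Qed.

End LqrCost.

Unset Implicit Arguments.
Set Strict Implicit.
Set Printing Implicit Defensive.

Theorem corollary4 (F : realType) (nx nu : nat)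
    (A : 'M[F]_nx) (B : 'M[F]_(nx, nu))
    (Q : 'M[F]_nx) (R : 'M[F]_nu) (S : 'M[F]_(nu, nx))
    (P : 'M[F]_nx) (K0 : 'M[F]_(nu, nx)) (tau rho : F)
    (d : measure_display) (T : measurableType d) (Pr : probability T F)
    (w : nat -> 'I_nx -> {RV Pr >-> F}) (x0 : 'cV[F]_nx)
    (H : nat) (H_gt0 : (0 < H)%N) (Lstar : 'I_H -> 'M[F]_(nu, nx)) :
  let Kstar := lqr_gain A B R S P in
  let Kbar := Kstar - K0 in
  let Sbar := R *m K0 + S in
  let Qbar := Q + K0^T *m S + S^T *m K0 + K0^T *m R *m K0 in
  (0 < nx)%N -> (0 < nu)%N ->
  posdefmx Q -> posdefmx R -> posdefmx (block_mx Q S^T S R) ->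
  possemidefmx P -> riccati_solution A B Q R S P ->
  1 <= tau -> 0 < rho ->
  exp_stable tau rho (A + B *m K0) ->
  exp_stable tau rho (A + B *m Kstar) ->
  gaussian_white_noise w ->
  (forall L : 'I_H -> 'M[F]_(nu, nx),
     (lqr_cost A B Q R S w x0 K0 Lstar <= lqr_cost A B Q R S w x0 K0 L)%E) ->
  spectral_norm (Kbar - Lstar (Ordinal H_gt0)) <=
    2 * tau ^+ 3
      * (spectral_norm B ^+ 2 * spectral_norm Kbar * spectral_norm Qbar
         + spectral_norm B * spectral_norm Kbar * spectral_norm Sbar)
      / (lambda_min (R - Sbar *m invmx Qbar *m Sbar^T)
         * (1 - expR (- (2 * rho))) `^ (5 / 2))
      * expR (- (H%:R * rho)).
Proof.
move=> Kstar Kbar Sbar Qbar nx_gt0 nu_gt0 posQ posR posW psdP ric tau_ge1 rho_gt0.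
move=> /exp_stable_pow Ac_stable /exp_stable_pow As_stable white Lopt.
have q_lt1 : expR (- rho) < 1 by rewrite expR_lt1 oppr_lt0.
have q_gt0 := expR_gt0 (- rho).
have Lmin (L : 'I_H -> 'M[F]_(nu, nx)) :
    filter_cost A B Q R S K0 Lstar <= filter_cost A B Q R S K0 L.
  have := Lopt L.
  rewrite !(lqr_costE _ _ _ _ _ white tau_ge1 q_gt0 q_lt1 Ac_stable) lee_fin.
  by rewrite ler_pM2l// normal_var_gt0.
apply: le_trans (optimal_filter_close nu_gt0 posQ.1 posR posW psdP ric tau_ge1
  q_gt0 q_lt1 Ac_stable As_stable H_gt0 Lmin) _.
rewrite -/Kstar -/Kbar -/Sbar -/Qbar.
have -> : expR (- (H%:R * rho)) = expR (- rho) ^+ H by rewrite -expRM_natl mulrN.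
have -> : expR (- (2 * rho)) = expR (- rho) ^+ 2 by rewrite -expRM_natl mulrN.
have r1 : 0 < 1 - expR (- rho) ^+ 2 by rewrite subr_gt0 expr_lt1// ltW.
(* The power 2 comes from the sums over the times after H, the root from Cauchy-Schwarz. *)
have -> : (1 - expR (- rho) ^+ 2) `^ (5 / 2) =
    (1 - expR (- rho) ^+ 2) ^+ 2 * Num.sqrt (1 - expR (- rho) ^+ 2).
  have -> : 5 / 2 = 2%:R + 2^-1 :> F by field.
  by rewrite powRD ?gt_eqF ?implybT// powR_mulrn ?(ltW r1)// powR12_sqrt// ltW.
rewrite sqrtrV ?(ltW r1)// !invfM le_eqVlt; apply/orP; left; apply/eqP.
by ring.
Qed.
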